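(* Let $\Bbbk$ be a field and let $H$ be a noetherian AS-Gorenstein Hopf algebra over $\Bbbk$ with antipode $S$. Then $$S^4=\gamma \circ \phi \circ \xi^{-1},$$ where $\xi$ and $\phi$ are respectively the left and right winding automorphisms of $H$ given by the left homological integral of $H$, and $\gamma$ is some inner automorphism of $H$.
   Context: Noetherian means left and right noetherian. ${}_\varepsilon\Bbbk$ (resp. $\Bbbk_\varepsilon$) is the left (resp. right) one-dimensional trivial $H$-module given by the counit $\varepsilon$. $\operatorname{Ext}_H$ is computed in left $H$-modules and $\operatorname{Ext}_{H^{\mathrm{op}}}$ in right $H$-modules. A noetherian Hopf algebra $H$ is AS-Gorenstein if, for some integer $d$: (AS1) the injective dimension of ${}_HH$ is $d<\infty$; (AS2) $\operatorname{Ext}_H^i({}_\varepsilon\Bbbk,H)=0$ for $i\neq d$ and $\dim_\Bbbk\operatorname{Ext}_H^d({}_\varepsilon\Bbbk,H)=1$; (AS3) the right-module versions of (AS1) and (AS2) hold (with $H_H$ and $\operatorname{Ext}_{H^{\mathrm{op}}}^i(\Bbbk_\varepsilon,H)$). The left homological integral of $H$ is the one-dimensional right $H$-module $\int^\ell=\operatorname{Ext}^d_H({}_\varepsilon\Bbbk,H)$, with right action induced by right multiplication on $H$. This right action is given by an algebra homomorphism $\chi:H\to\Bbbk$ (that is, $v\cdot a=\chi(a)v$ for $v\in\int^\ell$, $a\in H$). The left and right winding automorphisms given by $\int^\ell$ are $\xi(a)=\chi(a_1)a_2$ and $\phi(a)=a_1\chi(a_2)$ for $a\in H$, in sumless Sweedler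 notation $\Delta(a)=a_1\otimes a_2$. *)

(* Defs.v *)
From HB Require Import structures.
From mathcomp Require Import all_boot all_order all_algebra.
From mathcomp Require Import generic_quotient ring_quotient.
From mathcomp Require Import freeg boolp.

Set Implicit Arguments.
Unset Strict Implicit.
Unset Printing Implicit Defensive.

Import GRing.Theory.
Import Quotient.Exports.

Local Open Scope ring_scope.
Local Open Scope quotient_scope.

(* Left modules over a (noncommutative) ring A are the lmodType's over A; right
   modules are the lmodType's over the converse ring A^c. *)

Section QuotientModule.
Variables (R : nzRingType) (V : lmodType R) (N : submodClosed V).

Definition sub_of : {pred V} := fun x => x \in N.
Fact sub_of_closed : zmod_closed sub_of.
Proof.
split; first exact: (rpred0 N).
move=> x y; rewrite -2!topredE /= /sub_of => xN yN.
change (x - y \in N); rewrite -scaleN1r.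
by apply: rpredD => //; apply: rpredZ.
Qed.
HB.instance Definition _ := GRing.isZmodClosed.Build V sub_of sub_of_closed.

Definition quotmod := Quotient.quot sub_of.
HB.instance Definition _ := GRing.Zmodule.on quotmod.

Definition qpi (x : V) : quotmod := \pi_quotmod x.
Definition qrepr (x : quotmod) : V := repr x.

Lemma qreprK x : qpi (qrepr x) = x.
Proof. exact: reprK. Qed.

Lemma qpi_eq x y : (qpi x = qpi y) <-> x - y \in N.
Proof.
by rewrite -[x - y \in N]/(x - y \in sub_of) Quotient.idealrBE; split=> [/eqP|/eqP].
Qed.

Definition qscale (a : R) (x : quotmod) : quotmod := qpi (a *: qrepr x).

Fact qscaleE a x : qscale a (qpi x) = qpi (a *: x).
Proof.
by apply/qpi_eq; rewrite -scalerBr rpredZ //; apply/qpi_eq; rewrite qreprK.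
Qed.

Fact qpiD x y : qpi (x + y) = qpi x + qpi y.
Proof. by rewrite /qpi !piE. Qed.

Fact qscaleA a b v : qscale a (qscale b v) = qscale (a * b) v.
Proof. by rewrite -[v]qreprK !qscaleE scalerA. Qed.
Fact qscale1 : left_id 1 qscale.
Proof. by move=> v; rewrite -[v]qreprK !qscaleE scale1r. Qed.
Fact qscaleDr : right_distributive qscale +%R.
Proof.
by move=> a u v; rewrite -[u]qreprK -[v]qreprK -qpiD !qscaleE scalerDr qpiD.
Qed.
Fact qscaleDl v : {morph qscale^~ v : a b / a + b}.
Proof. by move=> a b; rewrite -[v]qreprK !qscaleE scalerDl qpiD. Qed.

HB.instance Definition _ := GRing.Zmodule_isLmodule.Build R quotmod
  qscaleA qscale1 qscaleDr qscaleDl.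

Fact qpi_linear : linear qpi.
Proof. by move=> a x y; rewrite qpiD -qscaleE. Qed.
HB.instance Definition _ := GRing.isLinear.Build R V quotmod *:%R qpi qpi_linear.

End QuotientModule.

Section Kernel.
Variables (R : nzRingType) (U V : lmodType R) (f : {linear U -> V}).

Definition ker_pred : {pred U} := fun x => f x == 0.
Fact ker_closed : subsemimod_closed ker_pred.
Proof.
split; first split.
- by rewrite unfold_in linear0.
- by move=> x y /eqP fx /eqP fy; rewrite unfold_in linearD fx fy addr0.
- by move=> a x /eqP fx; rewrite unfold_in linearZ /= fx scaler0.
Qed.
HB.instance Definition _ :=
  GRing.isSubmodClosed.Build R U ker_pred ker_closed.

Definition kermod := {x : U | ker_pred x}.
HB.instance Definition _ := SubChoice.on kermod.
HB.instance Definition _ := [SubChoice_isSubLmodule of kermod by <:].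

Lemma ker_val_eq0 (x : kermod) : val x = 0 <-> x = 0.
Proof. by split=> [vx0|->]; [apply: val_inj; rewrite vx0 raddf0|rewrite raddf0]. Qed.
End Kernel.

Section ConverseAlgebra.
Variables (k : comNzRingType) (A : algType k).

HB.instance Definition _ := GRing.Zmodule_isLmodule.Build k A^c
  (@scalerA k A) (@scale1r k A) (@scalerDr k A)
  (fun v => (fun a b => @scalerDl k A v a b)).

Fact conv_scalerAl (a : k) (u v : A^c) : a *: (u * v) = (a *: u) * v.
Proof. exact: (@scalerAr k A). Qed.
Fact conv_scalerAr (a : k) (u v : A^c) : a *: (u * v) = u * (a *: v).
Proof. exact: (@scalerAl k A). Qed.

HB.instance Definition _ := GRing.Lmodule_isLalgebra.Build k A^c conv_scalerAl.
HB.instance Definition _ := GRing.Lalgebra_isAlgebra.Build k A^c conv_scalerAr.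
End ConverseAlgebra.

Lemma linear_ext (R : nzRingType) (U V : lmodType R) (f g : {linear U -> V}) :
  f =1 g -> f = g.
Proof.
case: f g => [f [[f1] [f2]]] [g [[g1] [g2]]] /= /funext fg.
move: f1 f2 g1 g2; rewrite fg => f1 f2 g1 g2.
by congr GRing.Linear.Pack; congr GRing.Linear.Class; congr (_ _); apply: Prop_irrelevance.
Qed.

(* {freeg T / R} is the free left R-module on T, and fglift f its extension of
   f : T -> M to an R-linear map. *)
Section FreeModule.
Variables (R : nzRingType) (T : choiceType) (M : lmodType R).

Fact fglift_linear (f : T -> M) : linear (@fglift R M T f).
Proof.
pose L := @fglift R M T f; have Ladd := @lift_is_additive R T M f.
have L0 : L 0 = 0 by have := Ladd 0 0; rewrite !subrr.
have LN x : L (- x) = - L x by rewrite -[in LHS]sub0r [L _]Ladd -/L L0 sub0r.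
have LD x y : L (x + y) = L x + L y.
  by rewrite -{1}[y]opprK [L _]Ladd -/L LN opprK.
have LZ a x : L (a *: x) = a *: L x.
  rewrite -[x]freeg_sumE scaler_sumr.
  have Lsum (s : seq T) (F : T -> {freeg T / R}) :
      L (\sum_(z <- s) F z) = \sum_(z <- s) L (F z).
    by elim/big_rec2: _ => // z u v _ <-; rewrite LD.
  rewrite !Lsum scaler_sumr; apply: eq_bigr => z _.
  rewrite [a *: _](_ : _ = << a * coeff z x *g z >>).
    by rewrite /L !liftU scalerA.
  by apply/eqP/freeg_eqP => y; rewrite coeffZ !coeffU mulrA.
by move=> a x y; rewrite -/L LD LZ.
Qed.
HB.instance Definition _ f :=
  GRing.isLinear.Build R {freeg T / R} M *:%R (@fglift R M T f)
    (@fglift_linear f).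
End FreeModule.

Section Dual.
Variables (A : nzRingType) (M : lmodType A).

(* Hom_A(M, A) with the right A-module structure induced by the right
   multiplication on A. *)
Definition dual := {linear M -> A^o}.
HB.instance Definition _ := gen_eqMixin dual.
HB.instance Definition _ := gen_choiceMixin dual.

Definition dual0 : dual := @GRing.null_fun M A^o.
Definition dual_opp (f : dual) : dual := @GRing.opp_fun M A^o f.
Definition dual_add (f g : dual) : dual := @GRing.add_fun M A^o f g.

Fact dual_addA : associative dual_add.
Proof. by move=> f g h; apply: linear_ext => x; exact: addrA. Qed.
Fact dual_addC : commutative dual_add.
Proof. by move=> f g; apply: linear_ext => x; exact: addrC. Qed.
Fact dual_add0 : left_id dual0 dual_add.
Proof. by move=> f; apply: linear_ext => x; exact: add0r. Qed.
Fact dual_addN : left_inverse dual0 dual_opp dual_add.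
Proof. by move=> f; apply: linear_ext => x; exact: addNr. Qed.
HB.instance Definition _ :=
  GRing.isZmodule.Build dual dual_addA dual_addC dual_add0 dual_addN.

Definition mulr_fun (a : A) (f : M -> A^o) : M -> A^o := fun x => (f x : A) * a.
Fact mulr_fun_linear a (f : dual) : linear (mulr_fun a f).
Proof.
by move=> b x y; rewrite /mulr_fun linearP mulrDl /GRing.scale /= mulrA.
Qed.
HB.instance Definition _ a (f : dual) :=
  GRing.isLinear.Build A M A^o *:%R (mulr_fun a f) (@mulr_fun_linear a f).

Definition dual_scale (a : A^c) (f : dual) : dual := mulr_fun a f.

Fact dual_scaleA a b f : dual_scale a (dual_scale b f) = dual_scale (a * b) f.
Proof. by apply: linear_ext => x; rewrite /= /mulr_fun -mulrA. Qed.
Fact dual_scale1 : left_id 1 dual_scale.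
Proof. by move=> f; apply: linear_ext => x; exact: mulr1. Qed.
Fact dual_scaleDr : right_distributive dual_scale +%R.
Proof. by move=> a f g; apply: linear_ext => x; exact: mulrDl. Qed.
Fact dual_scaleDl f : {morph dual_scale^~ f : a b / a + b}.
Proof. by move=> a b; apply: linear_ext => x; exact: mulrDr. Qed.
HB.instance Definition _ := GRing.Zmodule_isLmodule.Build A^c dual
  dual_scaleA dual_scale1 dual_scaleDr dual_scaleDl.
End Dual.

Section DualMap.
Variables (A : nzRingType) (M N : lmodType A) (u : {linear M -> N}).

Definition dual_map (f : dual N) : dual M := [the {linear M -> A^o} of f \o u].
Fact dual_map_linear : linear dual_map.
Proof. by move=> a f g; apply: linear_ext. Qed.
HB.instance Definition _ :=
  GRing.isLinear.Build A^c (dual N) (dual M) *:%R dual_map dual_map_linear.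
End DualMap.

(* The standard free resolution of M: with K_0 = M and K_(n+1) the kernel of
   the canonical map from the free module on the set K_n onto K_n, the term of
   degree n is the free module on K_n. *)
Section StandardResolution.
Variable A : nzRingType.
Implicit Type M : lmodType A.

Definition free_cover M : {linear {freeg M / A} -> M} := @fglift A M M id.

Fixpoint syzygy M (n : nat) : lmodType A :=
  if n is m.+1 then kermod (free_cover (syzygy M m)) else M.

Definition res M (n : nat) : lmodType A := {freeg (syzygy M n) / A}.

Definition res_aug M : {linear res M 0 -> M} := free_cover M.

Definition res_d M n : {linear res M n.+1 -> res M n} :=
  [the {linear kermod (free_cover (syzygy M n)) -> _} of val]
    \o free_cover (syzygy M n.+1).

Lemma free_cover_surj M x : exists y, free_cover M y = x.
Proof. by exists << x >>; rewrite /= liftU scale1r. Qed.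

Definition projective_module (P : lmodType A) : Prop :=
  forall (U V : lmodType A) (g : {linear U -> V}) (f : {linear P -> V}),
    (forall v, exists u, g u = v) ->
    exists h : {linear P -> U}, forall x, g (h x) = f x.

Lemma res_projective M n : projective_module (res M n).
Proof.
move=> U V g f /choice[s gs]; set K := syzygy M n.
exists (@fglift A U K (fun x => s (f << x >>))) => D.
rewrite -[D]freeg_sumE !linear_sum; apply: eq_bigr => x _ /=.
rewrite liftU linearZ /= gs -linearZ /=; congr (f _).
by apply/eqP/freeg_eqP => y; rewrite coeffZ !coeffU mul1r.
Qed.

Lemma res_aug_surj M x : exists y, res_aug M y = x.
Proof. exact: free_cover_surj. Qed.

Lemma free_cover_ker (M N : lmodType A) (f : {linear M -> N}) x :
  f x = 0 <-> exists y, x = val (free_cover (kermod f) y).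
Proof.
split=> [fx0|[y ->]]; last by apply/eqP; exact: (valP (free_cover _ y)).
have xK : ker_pred f x by apply/eqP.
have [y yE] := free_cover_surj (exist _ x xK : kermod f).
by exists y; rewrite yE.
Qed.

Lemma res_exact0 M x : res_aug M x = 0 <-> exists y, x = res_d M 0 y.
Proof. exact: free_cover_ker. Qed.

Lemma res_exact M n x :
  res_d M n x = 0 <-> exists y, x = res_d M n.+1 y.
Proof.
rewrite -free_cover_ker; exact: ker_val_eq0.
Qed.
End StandardResolution.

(* Ext^n_A(M, A), as a right A-module: the cohomology of the complex of right
   A-modules obtained by applying Hom_A(-, A) to the resolution of M. *)
Section Ext.
Variables (A : nzRingType) (M : lmodType A).

Definition is_coboundary n : dual (res M n) -> Prop :=
  match n return dual (res M n) -> Prop with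
  | 0 => fun f => f = 0
  | m.+1 => fun f => exists g, f = dual_map (res_d M m) g
  end.

Fact is_coboundary0 n : @is_coboundary n 0.
Proof. by case: n => [|m] //=; exists 0; rewrite raddf0. Qed.
Fact is_coboundaryD n f g :
  @is_coboundary n f -> is_coboundary g -> is_coboundary (f + g).
Proof.
case: n f g => [|m] f g /=; first by move=> -> ->; rewrite addr0.
by case=> f' -> [g' ->]; exists (f' + g'); rewrite raddfD.
Qed.
Fact is_coboundaryZ n a f : @is_coboundary n f -> is_coboundary (a *: f).
Proof.
case: n f => [|m] f /=; first by move=> ->; rewrite scaler0.
by case=> f' ->; exists (a *: f'); rewrite linearZ.
Qed.

Variable n : nat.

Definition cocycle : lmodType A^c := @kermod A^c (dual (res M n)) (dual (res M n.+1)) (dual_map (res_d M n)).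

Definition coboundary : {pred cocycle} :=
  fun f => `[< is_coboundary (val f) >].

Fact coboundary_closed : subsemimod_closed coboundary.
Proof.
have cE (f : cocycle) : (f \in coboundary) <-> is_coboundary (val f).
  by rewrite unfold_in; split=> /asboolP.
split; first split.
- by apply/cE; rewrite raddf0; exact: is_coboundary0.
- move=> f g /cE fB /cE gB; apply/cE; rewrite raddfD.
  exact: is_coboundaryD.
- by move=> a f /cE fB; apply/cE; rewrite linearZ; exact: is_coboundaryZ.
Qed.
HB.instance Definition _ :=
  GRing.isSubmodClosed.Build A^c cocycle coboundary coboundary_closed.

Definition Ext_reg : lmodType A^c := quotmod coboundary.
End Ext.

Section InjectiveDimension.
Variable A : nzRingType.

Definition injective_module (I : lmodType A) : Prop :=
  forall (U V : lmodType A) (f : {linear U -> V}) (g : {linear U -> I}),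
    injective f -> exists h : {linear V -> I}, forall x, h (f x) = g x.

Definition inj_dim_le (M : lmodType A) (n : nat) : Prop :=
  exists (I : nat -> lmodType A) (e : {linear M -> I 0})
         (d : forall i, {linear I i -> I i.+1}),
    [/\ forall i, injective_module (I i),
        injective e,
        forall x, d 0 x = 0 <-> exists y, x = e y,
        forall i x, d i.+1 x = 0 <-> exists y, x = d i y
      & forall i, (n < i)%N -> forall x : I i, x = 0].

Definition inj_dim_eq (M : lmodType A) (n : nat) : Prop :=
  inj_dim_le M n /\ forall m, (m < n)%N -> ~ inj_dim_le M m.
End InjectiveDimension.

Definition left_noetherian (A : nzRingType) : Prop :=
  forall I : submodClosed A^o, exists s : seq A, forall x : A,
    x \in I <-> exists c : 'I_(size s) -> A, x = \sum_i c i * s`_i.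

Definition noetherian (A : nzRingType) : Prop :=
  left_noetherian A /\ left_noetherian A^c.

Section TrivialModule.
Variables (K : comNzRingType) (A : nzRingType) (e : {rmorphism A -> K}).

Definition trivmod_of of {rmorphism A -> K} : Type := K.
Definition trivmod := trivmod_of e.
HB.instance Definition _ := GRing.Zmodule.copy trivmod K.

Definition trivmod_scale (a : A) (c : trivmod) : trivmod := e a * (c : K).
Fact trivmod_scaleA a b v :
  trivmod_scale a (trivmod_scale b v) = trivmod_scale (a * b) v.
Proof. by rewrite /trivmod_scale rmorphM mulrA. Qed.
Fact trivmod_scale1 : left_id 1 trivmod_scale.
Proof. by move=> v; rewrite /trivmod_scale rmorph1 mul1r. Qed.
Fact trivmod_scaleDr : right_distributive trivmod_scale +%R.
Proof. by move=> a u v; exact: mulrDr. Qed.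
Fact trivmod_scaleDl v : {morph trivmod_scale^~ v : a b / a + b}.
Proof. by move=> a b; rewrite /trivmod_scale rmorphD; exact: mulrDl. Qed.
HB.instance Definition _ := GRing.Zmodule_isLmodule.Build A trivmod
  trivmod_scaleA trivmod_scale1 trivmod_scaleDr trivmod_scaleDl.

Definition conv_fun : A^c -> K := e.
Fact conv_fun_zmod : zmod_morphism conv_fun.
Proof. exact: (rmorphB e). Qed.
Fact conv_fun_monoid : monoid_morphism conv_fun.
Proof.
by split=> [|x y]; rewrite /conv_fun; [exact: rmorph1|rewrite rmorphM mulrC].
Qed.
HB.instance Definition _ := GRing.isZmodMorphism.Build A^c K conv_fun conv_fun_zmod.
HB.instance Definition _ :=
  GRing.isMonoidMorphism.Build A^c K conv_fun conv_fun_monoid.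
Definition conv_rmorph : {rmorphism A^c -> K} := conv_fun.
End TrivialModule.

(* U (x) V is the quotient of the free module on U x V by the bilinearity
   relations. *)
Section TensorProduct.
Variable k : comNzRingType.

Section TensorType.
Variables U V : lmodType k.
Local Notation F := {freeg (U * V) / k}.

Inductive tens_rel : F -> Prop :=
| tens_rel_l a u u' v :
    tens_rel (<< (a *: u + u', v) >> - (a *: << (u, v) >> + << (u', v) >>))
| tens_rel_r a u v v' :
    tens_rel (<< (u, a *: v + v') >> - (a *: << (u, v) >> + << (u, v') >>)).

Definition tens_sub : {pred F} := fun x =>
  `[< forall N : submodClosed F, (forall r, tens_rel r -> r \in N) -> x \in N >].
Fact tens_sub_closed : subsemimod_closed tens_sub.
Proof.
have sE x : (x \in tens_sub) <->
    forall N : submodClosed F, (forall r, tens_rel r -> r \in N) -> x \in N.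
  by rewrite unfold_in; split=> /asboolP.
split; first split.
- by apply/sE => N _; exact: rpred0.
- move=> x y /sE xS /sE yS; apply/sE => N NP.
  by apply: rpredD; [exact: xS|exact: yS].
- by move=> a x /sE xS; apply/sE => N NP; apply: rpredZ; exact: xS.
Qed.
HB.instance Definition _ :=
  GRing.isSubmodClosed.Build k F tens_sub tens_sub_closed.

Definition tensor : lmodType k := quotmod tens_sub.

Definition tens (u : U) (v : V) : tensor := qpi tens_sub << (u, v) >>.

(* The linear map induced by a bilinear map f (no meaning for other f). *)
Definition tlift (W : lmodType k) (f : U -> V -> W) (t : tensor) : W :=
  fglift (fun p => f p.1 p.2) (qrepr t).

Lemma tens_linear_l v : linear (tens^~ v).
Proof.
move=> a u u'; rewrite /tens -linearP; apply/qpi_eq.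
rewrite unfold_in; apply/asboolP => N; apply; exact: tens_rel_l.
Qed.

Lemma tens_linear_r u : linear (tens u).
Proof.
move=> a v v'; rewrite /tens -linearP; apply/qpi_eq.
rewrite unfold_in; apply/asboolP => N; apply; exact: tens_rel_r.
Qed.

Lemma tensor_span (t : tensor) :
  exists s : seq (U * V), exists c : U * V -> k,
    t = \sum_(p <- s) c p *: tens p.1 p.2.
Proof.
exists (dom (qrepr t)), (fun p => coeff p (qrepr t)).
rewrite -{1}[t]qreprK -{1}[qrepr t]freeg_sumE linear_sum.
apply: eq_bigr => -[u v] _ /=; rewrite /tens -linearZ; congr (qpi _ _).
by apply/eqP/freeg_eqP => y; rewrite coeffZ !coeffU mul1r.
Qed.

Section Lift.
Variables (W : lmodType k) (f : U -> V -> W).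
Hypotheses (fl : forall v, linear (f^~ v)) (fr : forall u, linear (f u)).

Let g : {linear F -> W} := @fglift k W _ (fun p => f p.1 p.2).

Fact tlift_pi x : tlift f (qpi tens_sub x) = g x.
Proof.
apply/eqP; rewrite -subr_eq0 -/(g (qrepr _)) -linearB.
have : qrepr (qpi tens_sub x) - x \in tens_sub by apply/qpi_eq; rewrite qreprK.
rewrite unfold_in => /asboolP/(_ (ker_pred g)) gP.
apply: gP => r []{r} *; rewrite unfold_in linearB linearD linearZ /=.
  by rewrite !liftU /= !scale1r fl subrr.
by rewrite !liftU /= !scale1r fr subrr.
Qed.

Lemma tliftE u v : tlift f (tens u v) = f u v.
Proof. by rewrite tlift_pi /= liftU scale1r. Qed.

Lemma tlift_linear : linear (tlift f).
Proof.
move=> a x y; rewrite -[x]qreprK -[y]qreprK -linearP !tlift_pi; exact: linearP.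
Qed.
End Lift.
End TensorType.

Definition tmap (U V U' V' : lmodType k) (f : U -> U') (g : V -> V') :
    tensor U V -> tensor U' V' :=
  tlift (fun u v => tens (f u) (g v)).

Definition tassoc (U V W : lmodType k) :
    tensor (tensor U V) W -> tensor U (tensor V W) :=
  tlift (fun t w => tlift (fun u v => tens u (tens v w)) t).

Definition tmul (A : algType k) (s t : tensor A A) : tensor A A :=
  tlift (fun a b => tmap ( *%R a) ( *%R b) t) s.

Lemma linear_tensor_ext (U V W : lmodType k) (f g : tensor U V -> W) :
  linear f -> linear g -> (forall u v, f (tens u v) = g (tens u v)) -> f =1 g.
Proof.
move=> fL gL fg t; have [s [c ->]] := tensor_span t.
pose f' : {linear tensor U V -> W} := HB.pack f (GRing.isLinear.Build _ _ _ _ f fL).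
pose g' : {linear tensor U V -> W} := HB.pack g (GRing.isLinear.Build _ _ _ _ g gL).
rewrite -[f]/(f' : _ -> _) -[g]/(g' : _ -> _) !linear_sum.
by apply: eq_bigr => p _; rewrite !linearZ /= fg.
Qed.

Section TensorMap.
Variables (U V U' V' : lmodType k) (f : {linear U -> U'}) (g : {linear V -> V'}).

Let tmap_l v : linear (fun u => tens (f u) (g v)).
Proof. by move=> a u u'; rewrite linearP; exact: tens_linear_l. Qed.
Let tmap_r u : linear (fun v => tens (f u) (g v)).
Proof. by move=> a v v'; rewrite linearP; exact: tens_linear_r. Qed.

Lemma tmapE u v : tmap f g (tens u v) = tens (f u) (g v).
Proof. exact: (tliftE tmap_l tmap_r). Qed.

Lemma tmap_linear : linear (tmap f g).
Proof. exact: (tlift_linear tmap_l tmap_r). Qed.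
End TensorMap.

Lemma tassocE (U V W : lmodType k) (u : U) (v : V) (w : W) :
  tassoc (tens (tens u v) w) = tens u (tens v w).
Proof.
have in_l w' v' : linear (fun u' : U => tens u' (tens v' w' : tensor V W)).
  exact: tens_linear_l.
have in_r w' (u' : U) : linear (fun v' : V => tens u' (tens v' w' : tensor V W)).
  by move=> a x y; rewrite tens_linear_l tens_linear_r.
have out_l w' : linear (fun t : tensor U V =>
    tlift (fun u v => tens u (tens v w' : tensor V W)) t).
  exact: (tlift_linear (in_l w') (in_r w')).
have out_r (t : tensor U V) : linear (fun w' =>
    tlift (fun u v => tens u (tens v w' : tensor V W)) t).
  move=> a x y; move: t; apply: linear_tensor_ext.
  - exact: (tlift_linear (in_l _) (in_r _)).
  - move=> b t t'; rewrite !(tlift_linear (in_l _) (in_r _)).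
    by rewrite !scalerDr !scalerA mulrC addrACA.
  - move=> u' v'; rewrite !(tliftE (in_l _) (in_r _)).
    by rewrite tens_linear_r tens_linear_r.
by rewrite /tassoc (tliftE out_l out_r); exact: (tliftE (in_l w) (in_r w)).
Qed.

Lemma tmulE (A : algType k) (a b c d : A) :
  tmul (tens a b) (tens c d) = tens (a * c) (b * d).
Proof.
have mulL (x : A) : linear ( *%R x) by move=> e y z; rewrite mulrDr -scalerAr.
pose mL x : {linear A -> A} :=
  HB.pack ( *%R x) (GRing.isLinear.Build _ _ _ _ ( *%R x) (mulL x)).
have out_l (y : A) : linear (fun x : A => tmap ( *%R x) ( *%R y) (tens c d)).
  move=> e x x'; move: (tens c d); apply: linear_tensor_ext.
  - exact: (tmap_linear (mL _) (mL _)).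
  - move=> e' t t'; rewrite !(tmap_linear (mL _) (mL _)).
    by rewrite !scalerDr !scalerA mulrC addrACA.
  - move=> u v; rewrite !(tmapE (mL _) (mL _)) /= mulrDl -scalerAl.
    exact: tens_linear_l.
have out_r (x : A) : linear (fun y : A => tmap ( *%R x) ( *%R y) (tens c d)).
  move=> e y y'; move: (tens c d); apply: linear_tensor_ext.
  - exact: (tmap_linear (mL _) (mL _)).
  - move=> e' t t'; rewrite !(tmap_linear (mL _) (mL _)).
    by rewrite !scalerDr !scalerA mulrC addrACA.
  - move=> u v; rewrite !(tmapE (mL _) (mL _)) /= mulrDl -scalerAl.
    exact: tens_linear_r.
by rewrite /tmul (tliftE out_l out_r); exact: (tmapE (mL a) (mL b)).
Qed.
End TensorProduct.

Record hopf_algebra (k : fieldType) (H : algType k) := HopfAlgebra {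
  comul : {linear H -> tensor H H};
  counit : {lrmorphism H -> k^o};
  antipode : {linear H -> H};
  comul_assoc : forall a,
    tassoc (tmap comul id (comul a)) = tmap id comul (comul a);
  counit_l : forall a, tlift (fun x y => (counit x : k) *: y) (comul a) = a;
  counit_r : forall a, tlift (fun x y => (counit y : k) *: x) (comul a) = a;
  comul1 : comul 1 = tens 1 1;
  comulM : forall a b, comul (a * b) = tmul (comul a) (comul b);
  antipode_l : forall a,
    tlift (fun x y => antipode x * y) (comul a) = (counit a : k)%:A;
  antipode_r : forall a,
    tlift (fun x y => x * antipode y) (comul a) = (counit a : k)%:A
}.

(* E is a k-vector space by restriction along c |-> c%:A. *)
Definition one_dimensional (k : fieldType) (A : algType k) (E : lmodType A) :
    Prop :=
  exists2 v : E, v != 0 & forall w : E, exists c : k, w = (c%:A : A) *: v.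

(* For A = H^c, left A-modules are the right H-modules, so that A^o is H_H and
   Ext_reg (trivmod e) i is Ext_(H^op)^i(k_eps, H). *)
Definition left_AS_Gorenstein (k : fieldType) (A : algType k)
    (e : {rmorphism A -> k^o}) (d : nat) : Prop :=
  [/\ inj_dim_eq A^o d,
      forall i, i <> d -> forall x : Ext_reg (trivmod e) i, x = 0
    & @one_dimensional k A^c (Ext_reg (trivmod e) d)].

Definition AS_Gorenstein (k : fieldType) (H : algType k)
    (hH : hopf_algebra H) (d : nat) : Prop :=
  left_AS_Gorenstein (counit hH) d /\
  @left_AS_Gorenstein k H^c (conv_rmorph (counit hH)) d.

(* Ext_H^d(k, H), a right H-module. *)
Definition left_integral (k : fieldType) (H : algType k)
    (hH : hopf_algebra H) (d : nat) : lmodType H^c :=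
  Ext_reg (trivmod (counit hH)) d.

Definition left_winding (k : fieldType) (H : algType k)
    (hH : hopf_algebra H) (chi : H -> k) (a : H) : H :=
  tlift (fun x y => chi x *: y) (comul hH a).

Definition right_winding (k : fieldType) (H : algType k)
    (hH : hopf_algebra H) (chi : H -> k) (a : H) : H :=
  tlift (fun x y => chi y *: x) (comul hH a).

Definition inner_automorphism (A : nzRingType) (g : A -> A) : Prop :=
  exists u v : A, [/\ u * v = 1, v * u = 1 & forall a, g a = u * a * v].

(* Main.v *)
(* Let R be the enveloping algebra of H and let delta : H -> R be the algebra map
   h |-> h_1 (x) S(h_2). Over delta(H), R is free on both sides, so a resolution
   of k by free left H-modules of finite rank becomes, by extension of scalars
   along delta, a resolution of the bimodule H by free R-modules; its Ext^d into R
   is the bimodule H with one side twisted by S^2 xi. The same construction for the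
   opposite and coopposite Hopf algebra starts from right modules and yields H with
   the other side twisted. Both compute Ext^d_R(H, R), and an isomorphism between
   the two bimodules is given by an element u of H satisfying
   a u = u S^2 xi (tau a), where tau describes the right-hand twist, with
   x |-> u S^2 xi (x) bijective. As H is noetherian u is a unit, hence S is
   bijective. The resolution of k by right modules can then be taken to be the image
   under S of the left one, in which case tau = S^2 phi^-1; as xi commutes with S^2
   this gives S^4 = gamma phi xi^-1. *)
Require Import Defs.
From HB Require Import structures.
From mathcomp Require Import all_boot all_order all_algebra.
From mathcomp Require Import freeg boolp classical_sets.

Set Implicit Arguments.
Unset Strict Implicit.
Unset Printing Implicit Defensive.

Import GRing.Theory.
Local Open Scope ring_scope.

(** * Comparison of free resolutions *)

(** Bijectivity of the antipode is a conclusion here, and this shapes the argument. The comparison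
    is run twice. With an arbitrary resolution of right modules no formula for the second twist is
    at hand, but the unit found already forces [S] to be bijective. With the transported resolution
    it gives another unit, and only this second one conjugates in the final formula. The [S^2] in
    the twists comes from solving [delta] for its first factor:
    [h (x) 1 = delta(h_1) (1 (x) S^2(h_2))]. In the second computation the generator carries the
    character [chi S^-1], which is [chi S] because [chi] and [chi S^2] are both convolution inverses
    of [chi S]; winding by it on the coopposite side is [phi^-1]. No bimodule is ever formed. All
    resolutions are sequences of matrices, change of rings acts on entries, and [Ext^d] is handled
    through one cocycle column [z] modulo coboundaries: every cocycle over [R] is [z (1 (x) y)] for
    a unique [y], so the action of [R] is recorded by formulas in [y]. *)

Lemma dependent_choice_seq (T : nat -> Type) (E : forall n, T n -> T n.+1 -> Prop)
    (t0 : T 0) :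
  (forall n t, exists t', @E n t t') ->
  exists2 s : forall n, T n, s 0 = t0 & forall n, E n (s n) (s n.+1).
Proof.
move=> ex; pose s := fix s n : T n :=
  if n is m.+1 then projT1 (cid (ex m (s m))) else t0.
by exists s => // n; exact: projT2 (cid (ex n (s n))).
Qed.

Section Comparison.
Variable A : nzRingType.

(* Projectivity, with the lifting problem restricted to the image of [g]; this
   spares the construction of image submodules. *)
Definition lifting_module (P : lmodType A) : Prop :=
  forall (U V : lmodType A) (g : {linear U -> V}) (f : {linear P -> V}),
    (forall x, exists u, f x = g u) ->
    exists h : {linear P -> U}, forall x, g (h x) = f x.

Lemma freeg_lifting (T : choiceType) : lifting_module {freeg T / A}.
Proof.
move=> U V g f fg.
have /choice[s gs] : forall x : T, exists u, f << x >> = g u by move=> x; exact: fg.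
exists (@fglift A U T s) => D.
rewrite -[D]freeg_sumE !linear_sum; apply: eq_bigr => x _ /=.
rewrite liftU linearZ /= -gs -linearZ /=; congr (f _).
by apply/eqP/freeg_eqP => y; rewrite coeffZ !coeffU mul1r.
Qed.

(** Identifies [Hom_A(A^n, A)] with columns; the right [A]-action on linear forms becomes right
    multiplication of a column by [a%:M]. *)
Definition rowdot n (c : 'cV[A]_n) (v : 'rV[A]_n) : A^o := (v *m c) 0 0.
Fact rowdot_linear n (c : 'cV[A]_n) : linear (rowdot c).
Proof. by move=> a u v; rewrite /rowdot mulmxDl -scalemxAl !mxE. Qed.
HB.instance Definition _ n (c : 'cV[A]_n) :=
  GRing.isLinear.Build A 'rV[A]_n A^o *:%R (rowdot c) (rowdot_linear c).

Definition dualcol n (f : 'rV[A]_n -> A^o) : 'cV[A]_n := \col_i f 'e_i.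

Lemma dualcolE n (f : {linear 'rV[A]_n -> A^o}) v : rowdot (dualcol f) v = f v.
Proof.
rewrite {2}[v]row_sum_delta linear_sum /rowdot mxE; apply: eq_bigr => i _.
by rewrite linearZ mxE.
Qed.

Lemma rowdotK n (c : 'cV[A]_n) : dualcol (rowdot c) = c.
Proof.
by apply/matrixP => i j; rewrite !mxE /rowdot -rowE mxE (ord1 j).
Qed.

Lemma rV_lifting n : lifting_module 'rV[A]_n.
Proof.
move=> U V g f fg.
have /choice[s gs] : forall i, exists u, f 'e_i = g u by move=> i; exact: fg.
pose h (v : 'rV[A]_n) := \sum_i v 0 i *: s i.
have hL : linear h.
  move=> a u v; rewrite /h scaler_sumr -big_split; apply: eq_bigr => i _ /=.
  by rewrite !mxE scalerDl scalerA.
pose h' : {linear 'rV[A]_n -> U} :=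
  HB.pack h (GRing.isLinear.Build _ _ _ _ h hL).
exists h' => v; rewrite [h' v]/(h v) /h linear_sum {2}[v]row_sum_delta linear_sum.
apply: eq_bigr => i _.
by rewrite !linearZ /= gs.
Qed.

Section Complexes.
Variables (P Q : nat -> lmodType A).
Variables (dP : forall n, {linear P n.+1 -> P n})
          (dQ : forall n, {linear Q n.+1 -> Q n}).
Hypothesis P_lift : forall n, lifting_module (P n).
Hypothesis dPK : forall n x, dP n (dP n.+1 x) = 0.
Hypothesis Q_exact : forall n x, dQ n x = 0 <-> exists y, x = dQ n.+1 y.

Lemma lift_chain_map (f0 : {linear P 0 -> Q 0}) :
  (forall x, exists y, f0 (dP 0 x) = dQ 0 y) ->
  exists2 f : forall n, {linear P n -> Q n},
    f 0 = f0 & forall n x, dQ n (f n.+1 x) = f n (dP n x).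
Proof.
move=> f0P.
(* Each stage carries the condition that makes the next lifting problem solvable. *)
pose T n := {f : {linear P n -> Q n} | forall x, exists y, f (dP n x) = dQ n y}.
pose E n (f : T n) (g : T n.+1) := forall x, dQ n (sval g x) = sval f (dP n x).
have [|s s0 sE] := @dependent_choice_seq T E (exist _ f0 f0P).
  move=> n [f fP].
  have [//|g gP] := @P_lift n.+1 _ _ (dQ n) [the {linear _ -> _} of f \o dP n].
  have gP' x : exists y, g (dP n.+1 x) = dQ n.+1 y.
    by apply/Q_exact; rewrite gP /= dPK linear0.
  by exists (exist _ g gP').
by exists (fun n => sval (s n)); rewrite ?s0.
Qed.

(** The homotopy is asserted one degree at a time: [t] need not be the [s] obtained one degree
    lower. For cohomology in a fixed degree this is enough, and it avoids choosing a whole coherent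
    sequence. *)
Lemma null_homotopic (h : forall n, {linear P n -> Q n}) :
  (forall n x, dQ n (h n.+1 x) = h n (dP n x)) ->
  (forall x, exists y, h 0 x = dQ 0 y) ->
  forall n, exists s : {linear P n -> Q n.+1},
    match n return {linear P n -> Q n.+1} -> Prop with
    | 0 => fun s => forall x, h 0 x = dQ 0 (s x)
    | m.+1 => fun s => exists t : {linear P m -> Q m.+1},
        forall x, h m.+1 x = dQ m.+1 (s x) + t (dP m x)
    end s.
Proof.
move=> hd h0; elim=> [|n [s sP]].
  by have [s sP] := P_lift h0; exists s => x; rewrite sP.
have [|s' s'P] := @P_lift n.+1 _ _ (dQ n.+1)
    [the {linear P n.+1 -> Q n.+1} of h n.+1 \- (s \o dP n)].
  move=> x; apply/Q_exact; rewrite /= linearB hd; case: n s sP x => [|n] s.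
    by move=> sP x; rewrite /= sP subrr.
  by case=> t tP x; rewrite /= tP dPK linear0 addr0 subrr.
by exists s', s => x; rewrite s'P /= subrK.
Qed.
End Complexes.

Section Coboundaries.
Variables (P : nat -> lmodType A) (dP : forall n, {linear P n.+1 -> P n}).

Definition lcoboundary n : (P n -> A^o) -> Prop :=
  match n return (P n -> A^o) -> Prop with
  | 0 => fun f => forall x, f x = 0
  | m.+1 => fun f =>
      exists g : {linear P m -> A^o}, forall x, f x = g (dP m x)
  end.
End Coboundaries.

Lemma lcoboundary_comp (P Q : nat -> lmodType A)
    (dP : forall n, {linear P n.+1 -> P n}) (dQ : forall n, {linear Q n.+1 -> Q n})
    (f : forall n, {linear P n -> Q n}) :
  (forall n x, dQ n (f n.+1 x) = f n (dP n x)) ->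
  forall n (g : Q n -> A^o), lcoboundary dQ g -> lcoboundary dP (g \o f n).
Proof.
move=> fd [|n] g /=; first by move=> g0 x; rewrite g0.
case=> g' gE; exists [the {linear _ -> _} of g' \o f n] => x /=.
by rewrite gE fd.
Qed.

(* Two chain maps which agree modulo boundaries in degree 0 are homotopic, and
   so induce the same map on the cohomology of Hom(-, A). *)
Lemma chain_map_coboundary (P Q : nat -> lmodType A)
    (dP : forall n, {linear P n.+1 -> P n}) (dQ : forall n, {linear Q n.+1 -> Q n})
    (f g : forall n, {linear P n -> Q n}) :
  (forall n, lifting_module (P n)) ->
  (forall n x, dP n (dP n.+1 x) = 0) ->
  (forall n x, dQ n x = 0 <-> exists y, x = dQ n.+1 y) ->
  (forall n x, dQ n (f n.+1 x) = f n (dP n x)) ->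
  (forall n x, dQ n (g n.+1 x) = g n (dP n x)) ->
  (forall x, exists y, f 0 x - g 0 x = dQ 0 y) ->
  forall n (u : {linear Q n -> A^o}), (forall x, u (dQ n x) = 0) ->
  lcoboundary dP (fun x => u (f n x) - u (g n x)).
Proof.
move=> Pl dPK Qex fd gd fg0 n u ud.
have hd m x : dQ m ((f m.+1 \- g m.+1) x) = (f m \- g m) (dP m x).
  by rewrite /= linearB fd gd.
have [s] := @null_homotopic P Q dP dQ Pl dPK Qex
  (fun m => [the {linear P m -> Q m} of f m \- g m]) hd fg0 n.
case: n s u ud => [|n] s u ud /=.
  by move=> sP x; rewrite -linearB sP ud.
case=> t tP; exists [the {linear P n -> A^o} of u \o t] => x /=.
by rewrite -linearB tP linearD ud add0r.
Qed.
End Comparison.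

(** * Resolutions by matrices *)

Section MatrixResolutions.
Variable A : nzRingType.

(* The ranks of a resolution of a cyclic module by free modules: 1, r 0, r 1, ... *)
Definition rk (r : nat -> nat) i := if i is j.+1 then r j else 1%N.

Definition matcomplex (r : nat -> nat) := forall i, 'M[A]_(rk r i.+1, rk r i).

(* A free resolution of the cyclic left module A / I, with maps acting on row
   vectors from the right. *)
Definition resolves r (D : matcomplex r) (I : A -> Prop) : Prop :=
  (forall i (v : 'rV[A]_(rk r i.+1)),
     v *m D i = 0 <-> exists w, v = w *m D i.+1) /\
  (forall a : A, I a <-> exists w, a%:M = w *m D 0).

Definition mcoboundary r (D : matcomplex r) n : 'cV[A]_(rk r n) -> Prop :=
  match n return 'cV[A]_(rk r n) -> Prop with
  | 0 => fun c => c = 0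
  | m.+1 => fun c => exists g, c = D m *m g
  end.

Section Basics.
Variables (r : nat -> nat) (D : matcomplex r).

Lemma mcoboundary0 n : mcoboundary D (0 : 'cV_(rk r n)).
Proof. by case: n => //= n; exists 0; rewrite mulmx0. Qed.

Lemma mcoboundaryB n (b c : 'cV_(rk r n)) :
  mcoboundary D b -> mcoboundary D c -> mcoboundary D (b - c).
Proof.
case: n b c => [|n] b c /=; first by move=> -> ->; rewrite subr0.
by case=> g -> [h ->]; exists (g - h); rewrite mulmxBr.
Qed.

Lemma mcoboundaryD n (b c : 'cV_(rk r n)) :
  mcoboundary D b -> mcoboundary D c -> mcoboundary D (b + c).
Proof.
move=> bB cB; rewrite -[c]opprK; apply: mcoboundaryB => //.
by rewrite -sub0r; apply: mcoboundaryB => //; exact: mcoboundary0.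
Qed.

Lemma mcoboundary_sum n (T : Type) (s : seq T) (F : T -> 'cV_(rk r n)) :
  (forall x, mcoboundary D (F x)) -> mcoboundary D (\sum_(x <- s) F x).
Proof.
move=> FB; elim/big_ind: _ => //; first exact: mcoboundary0.
exact: mcoboundaryD.
Qed.

Lemma mcoboundaryM n (c : 'cV_(rk r n)) (a : 'M_1) :
  mcoboundary D c -> mcoboundary D (c *m a).
Proof.
case: n c => [|n] c /=; first by move=> ->; rewrite mul0mx.
by case=> g ->; exists (g *m a); rewrite mulmxA.
Qed.

Variable I : A -> Prop.
Hypothesis DI : resolves D I.

Lemma resolves_sqr0 n : D n.+1 *m D n = 0.
Proof.
apply/row_matrixP => i; rewrite row_mul row0.
by apply/(DI.1 n); exists 'e_i; rewrite -rowE.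
Qed.

Lemma dualcol_coboundary n (f : 'rV_(rk r n) -> A^o) :
  @lcoboundary A (fun i => 'rV[A]_(rk r i)) (fun i => mulmxr (D i)) n f ->
  mcoboundary D (dualcol f).
Proof.
case: n f => [|n] f /=.
  by move=> f0; apply/matrixP => i j; rewrite !mxE f0.
case=> g gE; exists (dualcol g); apply/matrixP => i j.
by rewrite (ord1 j) mxE gE -dualcolE /rowdot -mulmxA -rowE mxE.
Qed.
End Basics.

Section CompareResolutions.
Variables (r s : nat -> nat) (D : matcomplex r) (E : matcomplex s) (I : A -> Prop).
Hypotheses (DI : resolves D I) (EI : resolves E I).

Lemma matrix_chain_map :
  exists2 F : forall n, 'M[A]_(rk r n, rk s n),
    F 0 = 1%:M & forall n, F n.+1 *m E n = D n *m F n.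
Proof.
have [||f f0 fd] := @lift_chain_map A (fun i => 'rV[A]_(rk r i))
  (fun i => 'rV[A]_(rk s i)) (fun i => mulmxr (D i)) (fun i => mulmxr (E i))
  (fun n => @rV_lifting A _) _ EI.1 (mulmxr 1%:M).
- by move=> n x /=; rewrite -mulmxA (resolves_sqr0 DI) mulmx0.
- move=> x /=; rewrite mulmx1 [x *m D 0]mx11_scalar.
  by apply/EI.2/DI.2; exists x; rewrite -mx11_scalar.
exists (fun n => lin1_mx (f n)) => [|n].
  by apply/row_matrixP => i; rewrite rowE mul_rV_lin1 f0 /= mulmx1 row1.
apply/row_matrixP => i; rewrite !row_mul [row i (lin1_mx _)]rowE !mul_rV_lin1.
by have /= := fd n 'e_i; rewrite -rowE.
Qed.
End CompareResolutions.

(** On [Hom(-, A)], the chain map [v |-> v *m F n] becomes left multiplication of columns by [F n].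
    Both [F *m G] and the identity lift the identity of the cyclic module, so they are homotopic. *)
Lemma matrix_homotopy r s (D : matcomplex r) (E : matcomplex s) (I : A -> Prop)
    (F : forall n, 'M[A]_(rk r n, rk s n)) (G : forall n, 'M[A]_(rk s n, rk r n)) :
  resolves D I -> F 0 = 1%:M -> G 0 = 1%:M ->
  (forall n, F n.+1 *m E n = D n *m F n) -> (forall n, G n.+1 *m D n = E n *m G n) ->
  forall n (c : 'cV_(rk r n)), D n *m c = 0 ->
    mcoboundary D (F n *m (G n *m c) - c).
Proof.
move=> DI F0 G0 FD GE n c Dc.
have := @chain_map_coboundary A (fun i => 'rV[A]_(rk r i))
  (fun i => 'rV[A]_(rk r i)) (fun i => mulmxr (D i)) (fun i => mulmxr (D i))
  (fun i => mulmxr (F i *m G i)) (fun i => mulmxr 1%:M)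
  (fun n => @rV_lifting A _) _ DI.1 _ _ _ n (rowdot c).
move=> /(_ _ _ _ _ _)/dualcol_coboundary; set w := dualcol _.
have -> : w = F n *m (G n *m c) - c.
  apply/matrixP => i j; rewrite (ord1 j) mxE [RHS]mxE [X in _ = _ + X]mxE.
  rewrite /= /rowdot mulmx1 -!mulmxA -!rowE.
  by congr (_ - _); rewrite mxE.
apply.
- by move=> i x /=; rewrite -mulmxA (resolves_sqr0 DI) mulmx0.
- by move=> i x /=; rewrite -!mulmxA GE !mulmxA -[x *m _ *m _]mulmxA FD mulmxA.
- by move=> i x /=; rewrite !mulmx1.
- by move=> x; exists 0; rewrite /= F0 G0 !mulmx1 subrr mul0mx.
- by move=> x; rewrite /= /rowdot -mulmxA Dc mulmx0 mxE.
Qed.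

(** * Finiteness over a noetherian ring *)

Section Noetherian.
Hypothesis An : left_noetherian A.

Lemma noetherian_ideal (I : A -> Prop) :
  I 0 -> (forall a x y, I x -> I y -> I (a * x + y)) ->
  exists n (g : 'cV[A]_n), forall x, I x <-> exists c : 'rV_n, x%:M = c *m g.
Proof.
move=> I0 IL; pose J : {pred A^o} := fun x => `[< I x >].
have JE x : (x \in J) <-> I x by rewrite unfold_in; split=> /asboolP.
have J_closed : subsemimod_closed J.
  split; first split; first exact/JE.
    by move=> x y /JE xI /JE yI; apply/JE; have := IL 1 x y xI yI; rewrite mul1r.
  by move=> a x /JE xI; apply/JE; have := IL a x 0 xI I0; rewrite addr0.
pose J' : submodClosed A^o :=
  HB.pack_for (submodClosed A^o) J (GRing.isSubmodClosed.Build A A^o J J_closed).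
have [s sP] := An J'; exists (size s), (\col_i s`_i) => x.
rewrite -JE -[x \in J]/(x \in J') sP; split=> [[c ->]|[c xE]].
  exists (\row_i c i); apply/matrixP => i j.
  by rewrite !mxE (ord1 i) (ord1 j) mulr1n; apply: eq_bigr => l _; rewrite !mxE.
exists (c 0); have := congr1 (fun M : 'M_1 => M 0 0) xE; rewrite !mxE mulr1n => ->.
by apply: eq_bigr => l _; rewrite mxE.
Qed.

(** Induction along [0 -> A^n -> A^(1+n) -> A -> 0]: lifts of generators of the ideal [I] of first
    coordinates, together with generators of the part [N'] with zero first coordinate, form the rows
    of [G]. *)
Lemma noetherian_rV n (N : 'rV[A]_n -> Prop) :
  N 0 -> (forall a x y, N x -> N y -> N (a *: x + y)) ->
  exists m (G : 'M[A]_(m, n)), forall v, N v <-> exists w, v = w *m G.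
Proof.
elim: n N => [|n IHn]; last rewrite -[n.+1]/(1 + n)%N; move=> N N0 NL.
  exists 0%N, 0 => v; split=> [_|_]; last by rewrite (thinmx0 v) -(thinmx0 0).
  by exists 0; rewrite !thinmx0.
pose N' (v : 'rV[A]_n) := N (row_mx (0 : 'rV_1) v).
have [||m' [G' G'P]] := IHn N'.
- by rewrite /N' row_mx0.
- by move=> a x y Nx Ny; have := NL a _ _ Nx Ny;
     rewrite scale_row_mx add_row_mx scaler0 addr0.
pose I (a : A) := exists v : 'rV[A]_n, N (row_mx a%:M v).
have [||m [g gP]] := noetherian_ideal (I := I).
- by exists 0; rewrite raddf0 row_mx0.
- move=> a x y [u Nu] [v Nv]; exists (a *: u + v); have := NL a _ _ Nu Nv.
  by rewrite scale_row_mx add_row_mx scale_scalar_mx -raddfD.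
have /choice[h hP] : forall i : 'I_m, exists v, N (row_mx (g i 0)%:M v).
  by move=> i; apply/gP; exists 'e_i; rewrite -rowE [row i g]mx11_scalar mxE.
have NM p q (B : 'M_(q, _)) (w : 'M_(p, q)) :
    (forall i, N (row i B)) -> forall i, N (row i (w *m B)).
  move=> BN i; rewrite row_mul mulmx_sum_row; elim/big_ind: _ => //.
    by move=> x y Nx Ny; rewrite -[x]scale1r; exact: NL.
  by move=> j _; rewrite -[_ *: _]addr0; exact: NL.
pose G := block_mx g (\matrix_i h i) 0 G'.
exists (m + m')%N, G => v.
have GN i : N (row i G).
  rewrite -[i]splitK; case: (split i) => j /=; rewrite /G block_mxEv.
    rewrite rowKu row_row_mx rowK [row j g]mx11_scalar mxE; exact: hP.
  rewrite rowKd row_row_mx row0; apply/G'P.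
  by exists 'e_j; rewrite -rowE.
split=> [Nv|[w ->]]; last first.
  by have := NM 1%N _ _ w GN 0; rewrite row_id.
have [c cE] : exists c, (v 0 0)%:M = c *m g.
  apply/gP; exists (@rsubmx _ 1 1 n v).
  rewrite (_ : (v 0 0)%:M = @lsubmx _ 1 1 n v) ?hsubmxK //.
  by rewrite [RHS]mx11_scalar mxE; congr (v _ _)%:M; apply: val_inj.
(* [w1] reproduces the first coordinate of [v], so the remainder is governed by [N']. *)
pose w1 : 'rV_(m + m') := row_mx c 0.
have w1N : N (v - w1 *m G).
  rewrite addrC -scaleN1r; apply: NL => //.
  by have := NM 1%N _ _ w1 GN 0; rewrite row_id.
have w1E : v - w1 *m G =
    row_mx 0 (@rsubmx _ 1 1 n (v - w1 *m G)).
  rewrite -[LHS](@hsubmxK _ 1 1 n); congr row_mx.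
  rewrite linearB /= /w1 /G mul_row_block mul0mx addr0 row_mxKl -cE.
  rewrite [X in X - _]mx11_scalar mxE (_ : lshift n 0 = 0) ?subrr //.
  exact: val_inj.
move: w1N; rewrite w1E => /G'P[w' w'E].
exists (w1 + row_mx 0 w'); rewrite mulmxDl -[LHS](subrK (w1 *m G)) addrC w1E w'E.
by rewrite /G [row_mx _ w' *m _]mul_row_block !mul0mx mulmx0 !add0r.
Qed.

Lemma noetherian_resolution (I : A -> Prop) :
  I 0 -> (forall a x y, I x -> I y -> I (a * x + y)) ->
  exists r (D : matcomplex r), resolves D I.
Proof.
move=> I0 IL; have [n0 [g0 g0P]] := noetherian_ideal I0 IL.
have syz m n (M : 'M[A]_(m, n)) : exists p (N : 'M[A]_(p, m)),
    forall v : 'rV_m, v *m M = 0 <-> exists w, v = w *m N.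
  apply: (noetherian_rV (N := fun v => v *m M = 0)) => [|a x y xM yM].
    exact: mul0mx.
  by rewrite mulmxDl -scalemxAl xM yM scaler0 addr0.
(* A matrix packed with its dimensions can be iterated on; the number of columns of [nxt t] is by
   conversion the number of rows of [t], so the maps of [D] compose. *)
pose st := {mn : nat * nat & 'M[A]_(mn.1, mn.2)}.
pose mk m n (M : 'M[A]_(m, n)) : st := existT _ (m, n) M.
pose nxt (t : st) : st := mk _ _ (projT1 (cid (projT2 (cid (syz _ _ (projT2 t)))))).
pose t i := iter i nxt (mk _ _ g0).
pose r i := (projT1 (t i)).1.
pose D : matcomplex r := fun i =>
  match i return 'M[A]_(rk r i.+1, rk r i) with
  | 0 => projT2 (t 0%N)
  | j.+1 => projT2 (t j.+1)
  end.
exists r, D; split; last exact: g0P.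
have ex i (v : 'rV_(_)) : v *m projT2 (t i) = 0 <-> exists w, v = w *m projT2 (t i.+1).
  exact: (projT2 (cid (projT2 (cid (syz _ _ (projT2 (t i))))))).
by case=> [|i] v; [exact: (ex 0%N v)|exact: (ex i.+1 v)].
Qed.

(* The annihilators of the powers of [v] stabilise. *)
Lemma noetherian_dedekind_finite (u v : A) : u * v = 1 -> v * u = 1.
Proof.
move=> uv; have uvn n : u ^+ n * v ^+ n = 1.
  elim: n => [|n IHn]; first by rewrite !expr0 mulr1.
  by rewrite exprS exprSr mulrA -[_ * v ^+ n]mulrA IHn mulr1.
pose I x := exists n, x * v ^+ n = 0.
have [||m [g gP]] := noetherian_ideal (I := I).
- by exists 0%N; rewrite mul0r.
- move=> a x y [m xm] [n yn]; exists (m + n)%N; rewrite mulrDl.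
  rewrite exprD mulrA -[a * x * _]mulrA xm mulr0 mul0r add0r.
  by rewrite -exprD addnC exprD mulrA yn mul0r.
have /choice[N NP] : forall i : 'I_m, I (g i 0).
  by move=> i; apply/gP; exists 'e_i; rewrite -rowE [row i g]mx11_scalar mxE.
pose n := (\max_i N i)%N.
have IN x : I x -> x * v ^+ n = 0.
  move/gP => [c xE]; have := congr1 (fun M : 'M_1 => M 0 0) xE.
  rewrite !mxE mulr1n => ->; rewrite mulr_suml big1 // => i _.
  have le_n : (N i <= n)%N by exact: leq_bigmax.
  rewrite -mulrA -(subnKC le_n) exprD [g i 0 * _]mulrA.
  by rewrite NP mul0r mulr0.
(* This element is killed by [v ^+ n.+1], hence already by [v ^+ n]; there [u ^+ n * v ^+ n = 1]
   leaves [v * u - 1]. *)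
have /IN : I ((v * u - 1) * u ^+ n).
  exists n.+1; rewrite exprSr -mulrA [u ^+ n * _]mulrA uvn mul1r.
  by rewrite mulrBl -mulrA uv mulr1 mul1r subrr.
by rewrite -mulrA uvn mulr1 => /eqP; rewrite subr_eq0 => /eqP.
Qed.
End Noetherian.
End MatrixResolutions.

(** * Passage from the standard resolution to a matrix resolution *)

Lemma is_coboundaryE (A : nzRingType) (M : lmodType A) n (f : dual (res M n)) :
  is_coboundary f <-> lcoboundary (res_d M) f.
Proof.
case: n f => [|n] f /=; first by split=> [->//|f0]; exact: linear_ext.
split=> [[g ->]|[g gE]]; first by exists g.
by exists g; exact: linear_ext.
Qed.

Lemma mulmx_scalar11 (A : nzRingType) n (c : 'cV[A]_n) a i j :
  (c *m a%:M) i j = c i j * a.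
Proof. by rewrite mxE big_ord1 mxE (ord1 j) mulr1n. Qed.

Lemma lcoboundaryB (A : nzRingType) (P : nat -> lmodType A)
    (dP : forall n, {linear P n.+1 -> P n}) n (f g : P n -> A^o) :
  lcoboundary dP f -> lcoboundary dP g -> lcoboundary dP (fun x => f x - g x).
Proof.
case: n f g => [|n] f g /=; first by move=> f0 g0 x; rewrite f0 g0 subrr.
case=> f' fE [g' gE]; exists [the {linear P n -> A^o} of f' \- g'] => x.
by rewrite fE gE.
Qed.

Lemma rowdot_coboundary (A : nzRingType) r (D : matcomplex A r) n
    (c : 'cV[A]_(rk r n)) :
  mcoboundary D c ->
  @lcoboundary A (fun i => 'rV[A]_(rk r i)) (fun i => mulmxr (D i)) n (rowdot c).
Proof.
case: n c => [|n] c /=; first by move=> -> x; rewrite /rowdot mulmx0 mxE.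
by case=> g ->; exists (rowdot g) => x; rewrite /= /rowdot mulmxA.
Qed.

Section StandardGenerator.
Variables (K : comNzRingType) (A : nzRingType) (e : {rmorphism A -> K}).
Hypothesis e_surj : forall c, exists a, e a = c.
Variables (r : nat -> nat) (D : matcomplex A r).
Hypothesis De : resolves D (fun a => e a = 0).
Local Notation M := (trivmod e).

Let eps (v : 'rV[A]_1) : M := e (v 0 0).
Let eps_linear : linear eps.
Proof. by move=> a u v; rewrite /eps !mxE rmorphD rmorphM. Qed.
Let epsL : {linear 'rV[A]_1 -> M} :=
  HB.pack eps (GRing.isLinear.Build _ _ _ _ eps eps_linear).

(** Surjectivity of [e] makes both complexes resolutions of the trivial module. Lifting its identity
    in both directions gives [f] and [g], whose composites are homotopic to the identities. *)
Lemma standard_comparison :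
  exists (f : forall n, {linear res M n -> 'rV[A]_(rk r n)})
         (g : forall n, {linear 'rV[A]_(rk r n) -> res M n}),
    [/\ forall n x, f n.+1 x *m D n = f n (res_d M n x),
        forall n x, res_d M n (g n.+1 x) = g n (x *m D n),
        forall n (u : {linear res M n -> A^o}), (forall x, u (res_d M n x) = 0) ->
          lcoboundary (res_d M) (fun x => u (g n (f n x)) - u x)
      & forall n (c : 'cV[A]_(rk r n)), D n *m c = 0 ->
          mcoboundary D (dualcol (fun x => rowdot c (f n (g n x))) - c)].
Proof.
have epsP (v : 'rV[A]_1) : eps v = 0 <-> exists w, v = w *m D 0.
  by rewrite {2}[v]mx11_scalar -(De.2 (v 0 0)).
have resK n x : res_d M n (res_d M n.+1 x) = 0.
  by apply/res_exact; exists x.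
have DK n (x : 'rV[A]_(rk r n.+2)) : x *m D n.+1 *m D n = 0.
  by rewrite -mulmxA (resolves_sqr0 De) mulmx0.
have [|f0 f0E] := @freeg_lifting A M 'rV[A]_1 M epsL (res_aug M).
  move=> x; have [a ea] := e_surj (res_aug M x).
  by exists a%:M; rewrite /= /eps mxE.
have [|g0 g0E] := @rV_lifting A 1 _ M (res_aug M) epsL.
  by move=> x; have [y yE] := res_aug_surj (epsL x); exists y.
have [|f f0' fd] := @lift_chain_map A (res M) (fun i => 'rV[A]_(rk r i))
  (res_d M) (fun i => mulmxr (D i)) (fun n => @freeg_lifting A _) resK De.1 f0.
  move=> x; apply/epsP; apply: etrans (f0E _) _.
  by apply/res_exact0; exists x.
have [|g g0' gd] := @lift_chain_map A (fun i => 'rV[A]_(rk r i)) (res M)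
  (fun i => mulmxr (D i)) (res_d M) (fun n => @rV_lifting A _) DK
  (@res_exact A M) g0.
  move=> x; apply/res_exact0; rewrite g0E /=; apply/epsP; by exists x.
exists f, g; split=> // n.
- move=> u ud; apply: (@chain_map_coboundary A (res M) (res M) (res_d M) (res_d M)
    (fun i => [the {linear res M i -> res M i} of g i \o f i])
    (fun i => [the {linear res M i -> res M i} of idfun])
    (fun n => @freeg_lifting A _) resK (@res_exact A M)) => //.
    by move=> i x; apply: etrans (gd _ _) _; apply: congr1; exact: fd.
  move=> x; apply/res_exact0.
  rewrite linearB /= g0' f0'; apply/eqP; rewrite subr_eq0; apply/eqP.
  exact: etrans (g0E _) (f0E _).
- move=> c Dc; have := @chain_map_coboundary A (fun i => 'rV[A]_(rk r i))
    (fun i => 'rV[A]_(rk r i)) (fun i => mulmxr (D i)) (fun i => mulmxr (D i))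
    (fun i => [the {linear 'rV[A]_(rk r i) -> 'rV[A]_(rk r i)} of f i \o g i])
    (fun i => [the {linear 'rV[A]_(rk r i) -> 'rV[A]_(rk r i)} of idfun])
    (fun n => @rV_lifting A _) DK De.1 _ _ _ n (rowdot c).
  move=> /(_ _ _ _ _)/dualcol_coboundary; set w := dualcol _.
  have -> : w = dualcol (fun x => rowdot c (f n (g n x))) - c.
    rewrite -[X in _ = _ - X]rowdotK; apply/matrixP => i j.
    by rewrite !mxE.
  apply=> //.
  + by move=> i x; apply: etrans (fd _ _) _; apply: congr1; exact: gd.
  + move=> x; apply/epsP; apply: etrans (linearB epsL _ _) _.
    rewrite /= g0' f0'; apply/eqP; rewrite subr_eq0; apply/eqP.
    exact: etrans (f0E _) (g0E _).
  + by move=> x; rewrite /= /rowdot -mulmxA Dc mulmx0 mxE.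
Qed.

(** Carries a generator of [Ext_reg] to a column [z]. Since [A] is only a ring here, the scalars of
    a base field are represented by the family [i], later [t |-> t%:A]. *)
Lemma standard_generator n (v : Ext_reg M n) :
  v != 0 ->
  exists z : 'cV[A]_(rk r n),
    [/\ D n *m z = 0, ~ mcoboundary D z,
        forall a b : A, (a : A^c) *: v = (b : A^c) *: v ->
          mcoboundary D (z *m a%:M - z *m b%:M)
      & forall (T : Type) (i : T -> A),
          (forall w : Ext_reg M n, exists t, w = (i t : A^c) *: v) ->
          forall c : 'cV[A]_(rk r n), D n *m c = 0 ->
          exists t, mcoboundary D (c - z *m (i t)%:M)].
Proof.
have [f [g [fd gd gf fg]]] := standard_comparison.
pose q : {linear cocycle M n -> Ext_reg M n} :=
  @qpi A^c (cocycle M n) (@coboundary A M n).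
have qE (x y : cocycle M n) : q x = q y <->
    lcoboundary (res_d M) (val x - val y : dual (res M n)).
  rewrite -[q x = q y]/(@qpi A^c _ (@coboundary A M n) x = qpi _ y).
  rewrite qpi_eq unfold_in -is_coboundaryE -raddfB.
  by split=> [/asboolP|?]; last exact/asboolP.
have qd (x : cocycle M n) y : (val x : dual (res M n)) (res_d M n y) = 0.
  by have /eqP/(congr1 (fun u : dual _ => u y)) := valP x; exact.
pose p := qrepr v; pose pf : dual (res M n) := val p.
have vE : v = q p by rewrite /q /= qreprK.
pose G (u : dual (res M n)) := dualcol (u \o g n).
have GB u w : G (u - w) = G u - G w by apply/matrixP => i j; rewrite !mxE.
have GZ (a : A^c) u : G (a *: u) = G u *m (a : A)%:M.
  by apply/matrixP => i j; rewrite mulmx_scalar11 !mxE.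
have Gcob (u : dual (res M n)) : lcoboundary (res_d M) u -> mcoboundary D (G u).
  move=> uB; apply: dualcol_coboundary.
  by apply: (lcoboundary_comp (dQ := res_d M)) uB => i x; rewrite gd.
have GE (u : dual (res M n)) x : rowdot (G u) x = u (g n x).
  exact: (dualcolE [the {linear 'rV[A]_(rk r n) -> A^o} of u \o g n]).
have qpZ (a : A^c) : a *: v = q (a *: p) by rewrite vE linearZ.
move=> v0; exists (G pf); split.
- apply/matrixP => i j; rewrite (ord1 j) [RHS]mxE.
  have := GE pf ('e_i *m D n); rewrite -gd qd /rowdot -mulmxA -rowE mxE.
  exact.
(* If [z] bounded, its pullback along [f] would bound too, and this pullback agrees with [pf] up to
   a coboundary, so [v] would vanish. *)
- move=> /rowdot_coboundary/(@lcoboundary_comp A (res M)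
    (fun i => 'rV[A]_(rk r i)) (res_d M) (fun i => mulmxr (D i)) f fd) zB.
  case/eqP: v0; rewrite vE -[RHS](linear0 q).
  apply/qE.
  have := lcoboundaryB zB (gf n pf (qd p)); congr (lcoboundary _ _).
  by apply/funext => x; rewrite /= GE subKr subr0.
- move=> a b; rewrite !qpZ => /qE abB.
  have := Gcob ((a : A^c) *: pf - (b : A^c) *: pf); rewrite GB !GZ; exact.
- move=> T i iP c Dc.
  (* The class of the pullback of [c] is a multiple of [v]; restricting back along [g] returns [c]
     up to a coboundary, by [fg]. *)
  pose u : dual (res M n) := [the {linear res M n -> A^o} of rowdot c \o f n].
  have uK : @ker_pred A^c (dual (res M n)) (dual (res M n.+1))
      (dual_map (res_d M n)) u.
    apply/eqP; apply: linear_ext => x; rewrite /= -fd /rowdot -mulmxA Dc.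
    by rewrite mulmx0 mxE.
  have [t tE] := iP (q (exist _ u uK)); exists t.
  have /Gcob : lcoboundary (res_d M) (u - (i t : A^c) *: pf : dual (res M n)).
    by move: tE; rewrite qpZ => /qE.
  rewrite GB GZ => uB; have := mcoboundaryB uB (fg n c Dc).
  by rewrite opprB [X in mcoboundary _ X]addrC addrA subrK.
Qed.
End StandardGenerator.

(** * Sweedler sums and convolution *)

Definition bilinear_fun (k : comNzRingType) (U V W : lmodType k)
    (f : U -> V -> W) : Prop :=
  (forall v, linear (f^~ v)) /\ (forall u, linear (f u)).

Definition trilinear_fun (k : comNzRingType) (U V W X : lmodType k)
    (f : U -> V -> W -> X) : Prop :=
  [/\ forall v w, linear (fun u => f u v w), forall u w, linear (fun v => f u v w)
    & forall u v, linear (fun w => f u v w)].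

Section LinearFunctions.
Variables (R : nzRingType) (U V : lmodType R).

Lemma linear_fun_sum (f : U -> V) (T : Type) (s : seq T) (F : T -> U) :
  linear f -> f (\sum_(x <- s) F x) = \sum_(x <- s) f (F x).
Proof.
move=> fL; pose g : {linear U -> V} := HB.pack f (GRing.isLinear.Build _ _ _ _ f fL).
exact: (linear_sum g).
Qed.

Lemma linear_fun_of_sum (T : Type) (s : seq T) (F : T -> U -> V) :
  (forall x, linear (F x)) -> linear (fun u => \sum_(x <- s) F x u).
Proof.
move=> FL a u v; rewrite scaler_sumr -big_split.
by apply: eq_bigr => x _; rewrite FL.
Qed.
End LinearFunctions.

Ltac bilinear := split=> ? ? ? ? /=;
  rewrite !(linearP, mulrDl, mulrDr, =^~ scalerAl, =^~ scalerAr) //.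
Ltac trilinear := split=> ? ? ? ? ? /=;
  rewrite !(linearP, mulrDl, mulrDr, =^~ scalerAl, =^~ scalerAr) //.

Section TensorMul.
Variables (k : comNzRingType) (A B : algType k).

(* The product of the algebra A (x) B; [tmul] is the case B = A. *)
Definition tensmul (s t : tensor A B) : tensor A B :=
  tlift (fun a b => tmap ( *%R a) ( *%R b) t) s.

Let mulL (C : algType k) (x : C) : linear ( *%R x).
Proof. by move=> e y z; rewrite mulrDr -scalerAr. Qed.
Let mL (C : algType k) (x : C) : {linear C -> C} :=
  HB.pack ( *%R x) (GRing.isLinear.Build _ _ _ _ ( *%R x) (mulL x)).

Let tensmul_bil (t : tensor A B) :
  bilinear_fun (fun (a : A) (b : B) => tmap ( *%R a) ( *%R b) t).
Proof.
split=> x e y z /=; move: t; apply: linear_tensor_ext.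
- exact: (tmap_linear (mL _) (mL _)).
- move=> e' t t'; rewrite !(tmap_linear (mL _) (mL _)).
  by rewrite !scalerDr !scalerA mulrC addrACA.
- move=> u v; rewrite !(tmapE (mL _) (mL _)) /= mulrDl -scalerAl.
  exact: tens_linear_l.
- exact: (tmap_linear (mL _) (mL _)).
- move=> e' t t'; rewrite !(tmap_linear (mL _) (mL _)).
  by rewrite !scalerDr !scalerA mulrC addrACA.
- move=> u v; rewrite !(tmapE (mL _) (mL _)) /= mulrDl -scalerAl.
  exact: tens_linear_r.
Qed.

Lemma tensmulE (a c : A) (b d : B) :
  tensmul (tens a b) (tens c d) = tens (a * c) (b * d).
Proof.
have [fl fr] := tensmul_bil (tens c d).
by rewrite /tensmul tliftE // (tmapE (mL a) (mL b)).
Qed.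

Lemma tensmul_bilinear : bilinear_fun tensmul.
Proof.
split=> [t|s]; first by have [fl fr] := tensmul_bil t; exact: tlift_linear.
move=> c t t'; move: s; apply: linear_tensor_ext.
- by have [fl fr] := tensmul_bil (c *: t + t'); exact: tlift_linear.
- have [fl fr] := tensmul_bil t; have [fl' fr'] := tensmul_bil t'.
  move=> e u v; rewrite /tensmul !(tlift_linear fl fr) !(tlift_linear fl' fr').
  by rewrite !scalerDr !scalerA mulrC addrACA.
- move=> u v; rewrite /tensmul.
  have [fl fr] := tensmul_bil t; have [fl' fr'] := tensmul_bil t'.
  have [gl gr] := tensmul_bil (c *: t + t').
  by rewrite !tliftE // (tmap_linear (mL _) (mL _)).
Qed.
End TensorMul.

Lemma tassoc_linear (k : comNzRingType) (U V W : lmodType k) :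
  linear (@tassoc k U V W).
Proof.
have in_l w v : linear (fun u : U => tens u (tens v w : tensor V W)).
  exact: tens_linear_l.
have in_r w (u : U) : linear (fun v : V => tens u (tens v w : tensor V W)).
  by move=> b x y; rewrite tens_linear_l tens_linear_r.
apply: tlift_linear => [w|t]; first exact: (tlift_linear (in_l w) (in_r w)).
move=> b x y; move: t; apply: linear_tensor_ext.
- exact: (tlift_linear (in_l _) (in_r _)).
- move=> e t t'; rewrite !(tlift_linear (in_l _) (in_r _)).
  by rewrite !scalerDr !scalerA mulrC addrACA.
- move=> u' v'; rewrite !(tliftE (in_l _) (in_r _)).
  by rewrite tens_linear_r tens_linear_r.
Qed.

Section Sweedler.
Variables (k : fieldType) (H : algType k) (hH : hopf_algebra H).
Local Notation Delta := (comul hH).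
Local Notation S := (antipode hH).
Local Notation eps := (counit hH).

Lemma comul_sum a : exists s : seq (H * H), Delta a = \sum_(p <- s) tens p.1 p.2.
Proof.
have [s [c ->]] := tensor_span (Delta a).
exists [seq (c p *: p.1, p.2) | p <- s]; rewrite big_map.
apply: eq_bigr => p _ /=.
have := @tens_linear_l k H H p.2 (c p) p.1 0.
have := @tens_linear_l k H H p.2 1 0 0.
rewrite scaler0 addr0 scale1r -[LHS]addr0 => /addrI <-.
by rewrite !addr0.
Qed.

(* [sw a] lists the pairs [(a_1, a_2)] of Sweedler's notation. *)
Definition sw (a : H) : seq (H * H) := projT1 (cid (comul_sum a)).

Lemma comulE a : Delta a = \sum_(p <- sw a) tens p.1 p.2.
Proof. exact: projT2 (cid (comul_sum a)). Qed.

Section Bilinear.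
Variables (W : lmodType k) (f : H -> H -> W).
Hypothesis fB : bilinear_fun f.

Lemma tlift_sum (s : seq (H * H)) :
  tlift f (\sum_(p <- s) tens p.1 p.2) = \sum_(p <- s) f p.1 p.2.
Proof.
have [fl fr] := fB; rewrite (linear_fun_sum _ _ (tlift_linear fl fr)).
by apply: eq_bigr => p _; rewrite tliftE.
Qed.

Lemma tlift_sw a : tlift f (Delta a) = \sum_(p <- sw a) f p.1 p.2.
Proof. by rewrite comulE tlift_sum. Qed.

Lemma sw_linear : linear (fun a => \sum_(p <- sw a) f p.1 p.2).
Proof.
have [fl fr] := fB.
by move=> a u v; rewrite -!tlift_sw linearP (tlift_linear fl fr).
Qed.

Lemma sw1 : \sum_(p <- sw 1) f p.1 p.2 = f 1 1.
Proof.
by have [fl fr] := fB; rewrite -tlift_sw comul1 tliftE.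
Qed.

Lemma swM a b : \sum_(p <- sw (a * b)) f p.1 p.2 =
  \sum_(p <- sw a) \sum_(q <- sw b) f (p.1 * q.1) (p.2 * q.2).
Proof.
have [fl fr] := fB; rewrite -tlift_sw comulM -[tmul _ _]/(tensmul _ _) comulE.
rewrite (linear_fun_sum _ _ ((@tensmul_bilinear k H H).1 _))
  (linear_fun_sum _ _ (tlift_linear fl fr)).
apply: eq_bigr => p _; rewrite comulE.
rewrite (linear_fun_sum _ _ ((@tensmul_bilinear k H H).2 _))
  (linear_fun_sum _ _ (tlift_linear fl fr)).
by apply: eq_bigr => q _; rewrite tensmulE tliftE.
Qed.
End Bilinear.

(** The lists [sw a] are arbitrary representatives, so coassociativity is usable only through a
    multilinear [f]: both sums are the value of the map induced by [f] on the triple tensor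
    product. *)
Lemma sw_coassoc (W : lmodType k) (f : H -> H -> H -> W) a :
  trilinear_fun f ->
  \sum_(p <- sw a) \sum_(q <- sw p.1) f q.1 q.2 p.2 =
  \sum_(p <- sw a) \sum_(q <- sw p.2) f p.1 q.1 q.2.
Proof.
case=> f1 f2 f3.
have fxB x : bilinear_fun (f x) by split=> [z|y]; [exact: f2|exact: f3].
pose g x t := tlift (f x) t.
have gB : bilinear_fun g.
  split=> [t|x]; last by have [? ?] := fxB x; exact: tlift_linear.
  move=> c x x'; move: t; rewrite /g; apply: linear_tensor_ext.
  - by have [? ?] := fxB (c *: x + x'); exact: tlift_linear.
  - have [l r] := fxB x; have [l' r'] := fxB x'; move=> e u v.
    rewrite !(tlift_linear l r) !(tlift_linear l' r').
    by rewrite !scalerDr !scalerA mulrC addrACA.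
  - move=> u v; have [l r] := fxB x; have [l' r'] := fxB x'.
    by have [l'' r''] := fxB (c *: x + x'); rewrite !tliftE // f1.
have [gl gr] := gB; have gL := tlift_linear gl gr.
pose idL : {linear H -> H} := [the {linear H -> H} of idfun].
have := congr1 (tlift g) (comul_assoc hH a).
rewrite [in LHS]comulE [in RHS]comulE.
rewrite (linear_fun_sum _ _ (tmap_linear Delta idL)).
rewrite (linear_fun_sum _ _ (tmap_linear idL Delta)).
rewrite (linear_fun_sum _ _ (@tassoc_linear k H H H)) !(linear_fun_sum _ _ gL).
have -> : \sum_(p <- sw a) tlift g (tassoc (tmap Delta id (tens p.1 p.2))) =
    \sum_(p <- sw a) \sum_(q <- sw p.1) f q.1 q.2 p.2.
  apply: eq_bigr => p _; rewrite (tmapE Delta idL) comulE.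
  have tl := tens_linear_l (U := tensor H H) (p.2 : H).
  rewrite (linear_fun_sum _ _ tl) (linear_fun_sum _ _ (@tassoc_linear k H H H)).
  rewrite (linear_fun_sum _ _ gL); apply: eq_bigr => q _.
  rewrite tassocE tliftE // /g; have [l r] := fxB q.1; exact: tliftE.
move=> ->; apply: eq_bigr => p _.
rewrite (tmapE idL Delta) tliftE // /g; exact: tlift_sw.
Qed.

Lemma counit_sw_l a : \sum_(p <- sw a) (eps p.1 : k) *: p.2 = a.
Proof.
rewrite -{2}[a](counit_l hH); rewrite tlift_sw //; split=> x c y z.
  by rewrite linearP scalerDl -scalerA.
by rewrite scalerDr !scalerA mulrC.
Qed.

Lemma counit_sw_r a : \sum_(p <- sw a) (eps p.2 : k) *: p.1 = a.
Proof.
rewrite -{2}[a](counit_r hH); rewrite tlift_sw //; split=> x c y z.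
  by rewrite scalerDr !scalerA mulrC.
by rewrite linearP scalerDl -scalerA.
Qed.

Lemma antipode_sw_l a : \sum_(p <- sw a) S p.1 * p.2 = (eps a : k)%:A.
Proof. rewrite -antipode_l tlift_sw //; bilinear. Qed.

Lemma antipode_sw_r a : \sum_(p <- sw a) p.1 * S p.2 = (eps a : k)%:A.
Proof. rewrite -antipode_r tlift_sw //; bilinear. Qed.

Lemma antipode1 : S 1 = 1.
Proof.
have := antipode_sw_l 1; rewrite (sw1 (f := fun x y => S x * y)); last bilinear.
by rewrite mulr1 rmorph1 scale1r.
Qed.

(** Both sides are convolution inverses of the multiplication [H (x) H -> H]. The uniqueness
    argument is written out in Sweedler sums; [T] is the convolution of multiplication with the
    right-hand side. *)
Lemma antipodeM a b : S (a * b) = S b * S a.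
Proof.
pose T x y := \sum_(p <- sw x) \sum_(q <- sw y) p.1 * q.1 * (S q.2 * S p.2).
have TE x y : T x y = (eps x * eps y : k)%:A.
  rewrite /T -[RHS]mulr1 -scalerAl mulrC -scalerA mul1r -antipode_sw_r scaler_sumr.
  apply: eq_bigr => p _.
  transitivity (p.1 * (\sum_(q <- sw y) q.1 * S q.2) * S p.2).
    by rewrite mulr_sumr mulr_suml; apply: eq_bigr => q _; rewrite !mulrA.
  by rewrite antipode_sw_r -scalerAr mulr1 scalerAl.
transitivity (\sum_(p <- sw a) \sum_(q <- sw b) S (p.1 * q.1) * T p.2 q.2).
  rewrite -{1}(counit_sw_r a) -{1}(counit_sw_r b) mulr_suml linear_sum.
  apply: eq_bigr => p _; rewrite mulr_sumr linear_sum; apply: eq_bigr => q _.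
  by rewrite TE -scalerAl -!scalerAr mulr1 scalerA linearZ.
transitivity (\sum_(p <- sw a) \sum_(p' <- sw p.2) \sum_(q <- sw b)
    \sum_(q' <- sw q.2) S (p.1 * q.1) * (p'.1 * q'.1 * (S q'.2 * S p'.2))).
  apply: eq_bigr => p _; rewrite exchange_big /=; apply: eq_bigr => q _.
  by rewrite /T mulr_sumr; apply: eq_bigr => p' _; rewrite mulr_sumr.
pose F x y z := \sum_(q <- sw b) \sum_(q' <- sw q.2)
   S (x * q.1) * (y * q'.1 * (S q'.2 * S z)).
rewrite -(sw_coassoc (f := F)); last first.
  by split=> ? ?; apply: linear_fun_of_sum => ?; apply: linear_fun_of_sum => ? ? ? ?;
    rewrite !(linearP, mulrDl, mulrDr, =^~ scalerAl, =^~ scalerAr).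
pose G x y z x' y' z' := S (x * x') * (y * y' * (S z' * S z)).
have GE x y z : F x y z = \sum_(q <- sw b) \sum_(q' <- sw q.1) G x y z q'.1 q'.2 q.2.
  by rewrite (sw_coassoc (f := G x y z)) // /G; trilinear.
(* Regrouping by coassociativity in [a] and in [b] exposes the antipode axiom for the product
   [p.1 * q.1]. *)
transitivity (\sum_(p <- sw a) \sum_(q <- sw b)
    (\sum_(x <- sw (p.1 * q.1)) S x.1 * x.2) * (S q.2 * S p.2)).
  apply: eq_bigr => p _; under eq_bigr => p' _ do rewrite GE.
  rewrite exchange_big; apply: eq_bigr => q _ /=.
  rewrite (swM (f := fun x y => S x * y)); last by bilinear.
  rewrite mulr_suml; apply: eq_bigr => p' _; rewrite mulr_suml.
  by apply: eq_bigr => q' _; rewrite /G !mulrA.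
rewrite -{2}(counit_sw_l a) -{2}(counit_sw_l b) exchange_big linear_sum mulr_suml.
apply: eq_bigr => q _; rewrite linear_sum mulr_sumr.
apply: eq_bigr => p _; rewrite antipode_sw_l -scalerAl mul1r rmorphM.
by rewrite !linearZ /= -scalerAl -scalerAr scalerA mulrC.
Qed.

Lemma counit_antipode a : eps (S a) = eps a.
Proof.
have := congr1 eps (antipode_sw_l a); rewrite linear_sum linearZ /= rmorph1.
rewrite [_ *: 1]mulr1 => <-; rewrite -{1}(counit_sw_r a) !linear_sum.
by apply: eq_bigr => p _; rewrite !linearZ rmorphM /= mulrC.
Qed.

Section Convolution.
Variable B : algType k.
Implicit Types f g h : {linear H -> B}.

Lemma mul_bilinear f g : bilinear_fun (fun x y => f x * g y).
Proof. bilinear. Qed.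

Definition conv f g a := \sum_(p <- sw a) f p.1 * g p.2.
Fact conv_linear f g : linear (conv f g).
Proof. exact: (sw_linear (mul_bilinear f g)). Qed.
HB.instance Definition _ f g :=
  GRing.isLinear.Build k H B *:%R (conv f g) (conv_linear f g).

Lemma eq_conv f f' g g' : f =1 f' -> g =1 g' -> conv f g =1 conv f' g'.
Proof. by move=> ff gg a; apply: eq_bigr => p _; rewrite ff gg. Qed.

Lemma convA f g h : conv f (conv g h) =1 conv (conv f g) h.
Proof.
move=> a; symmetry; transitivity
  (\sum_(p <- sw a) \sum_(q <- sw p.1) f q.1 * g q.2 * h p.2).
  by apply: eq_bigr => p _; rewrite mulr_suml.
rewrite (sw_coassoc (f := fun x y z => f x * g y * h z)); last by trilinear.
apply: eq_bigr => p _; rewrite mulr_sumr.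
by apply: eq_bigr => q _; rewrite mulrA.
Qed.

Definition convone (a : H) : B := (eps a : k)%:A.
Fact convone_linear : linear convone.
Proof. by move=> c x y; rewrite /convone linearP scalerDl scalerA. Qed.
HB.instance Definition _ := GRing.isLinear.Build k H B *:%R convone convone_linear.

Lemma conv1f f : conv convone f =1 f.
Proof.
move=> a; rewrite -{2}(counit_sw_l a) linear_sum; apply: eq_bigr => p _.
by rewrite linearZ /convone -scalerAl mul1r.
Qed.

Lemma convf1 f : conv f convone =1 f.
Proof.
move=> a; rewrite -{2}(counit_sw_r a) linear_sum; apply: eq_bigr => p _.
by rewrite linearZ /convone -scalerAr mulr1.
Qed.

Lemma conv_inv_unique f g h :
  conv f g =1 convone -> conv g h =1 convone -> f =1 h.
Proof.
move=> fg gh a; rewrite -(convf1 f) -(conv1f h).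
transitivity (conv f (conv g h) a).
  by apply: eq_conv => // x; symmetry; exact: gh.
by rewrite convA; apply: eq_conv.
Qed.
End Convolution.
End Sweedler.

(** * Winding automorphisms *)

Section ConvolutionMorphisms.
Variables (k : fieldType) (H : algType k) (hH : hopf_algebra H) (B : algType k).
Implicit Types f g h : {linear H -> B}.
Local Notation S := (antipode hH).

Lemma conv_morph f g :
  {morph f : x y / x * y} -> {morph g : x y / x * y} ->
  (forall x y, f x * g y = g y * f x) -> {morph conv hH f g : x y / x * y}.
Proof.
move=> fM gM fg x y.
rewrite /conv (swM hH (mul_bilinear f g)).
rewrite mulr_suml; apply: eq_bigr => p _; rewrite mulr_sumr.
apply: eq_bigr => q _.
by rewrite fM gM -!mulrA; congr (_ * _); rewrite !mulrA fg.
Qed.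

Lemma conv_one f g : conv hH f g 1 = f 1 * g 1.
Proof. exact: (sw1 _ (mul_bilinear f g)). Qed.

Section Antipode.
Variable f : {linear H -> B}.
Hypotheses (fM : {morph f : x y / x * y}) (f1 : f 1 = 1).

Lemma conv_antipode_r : conv hH f (f \o S) =1 convone hH B.
Proof.
move=> a; rewrite /convone -{1}f1 -linearZ -antipode_sw_r linear_sum.
by apply: eq_bigr => p _; rewrite fM.
Qed.

Lemma conv_antipode_l : conv hH (f \o S) f =1 convone hH B.
Proof.
move=> a; rewrite /convone -{1}f1 -linearZ -antipode_sw_l linear_sum.
by apply: eq_bigr => p _; rewrite fM.
Qed.
End Antipode.
End ConvolutionMorphisms.

Section Winding.
Variables (k : fieldType) (H : algType k) (hH : hopf_algebra H).
Local Notation S := (antipode hH).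
Local Notation eps := (counit hH).
Local Notation idH := [the {linear H -> H} of idfun].
Implicit Types c : {linear H -> k^o}.

Section Functional.
Variable c : {linear H -> k^o}.
Local Notation lw := (left_winding hH c).
Local Notation rw := (right_winding hH c).

Let lwB : bilinear_fun (fun x y : H => (c x : k) *: y).
Proof.
split=> x d y z; first by rewrite linearP scalerDl scalerA.
by rewrite scalerDr !scalerA mulrC.
Qed.
Let rwB : bilinear_fun (fun x y : H => (c y : k) *: x).
Proof.
split=> x d y z; last by rewrite linearP scalerDl scalerA.
by rewrite scalerDr !scalerA mulrC.
Qed.

Lemma left_windingE a : lw a = \sum_(p <- sw hH a) (c p.1 : k) *: p.2.
Proof. exact: (tlift_sw hH lwB). Qed.

Lemma right_windingE a : rw a = \sum_(p <- sw hH a) (c p.2 : k) *: p.1.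
Proof. exact: (tlift_sw hH rwB). Qed.

Fact left_winding_linear : linear lw.
Proof. by move=> d x y; rewrite !left_windingE; exact: (sw_linear hH lwB). Qed.
HB.instance Definition _ := GRing.isLinear.Build k H H *:%R lw left_winding_linear.

Fact right_winding_linear : linear rw.
Proof. by move=> d x y; rewrite !right_windingE; exact: (sw_linear hH rwB). Qed.
HB.instance Definition _ := GRing.isLinear.Build k H H *:%R rw right_winding_linear.

Section Bilinear.
Variables (W : lmodType k) (f : H -> H -> W).
Hypothesis fB : bilinear_fun f.

Let fZl d x y : f (d *: x) y = d *: f x y.
Proof.
have f0 : f 0 y = 0.
  by have := fB.1 y 1 0 0; rewrite !scale1r addr0 -[LHS]addr0 => /addrI.
by have := fB.1 y d x 0; rewrite /= !addr0 f0 addr0.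
Qed.
Let fZr d x y : f x (d *: y) = d *: f x y.
Proof.
have f0 : f x 0 = 0.
  by have := fB.2 x 1 0 0; rewrite !scale1r addr0 -[LHS]addr0 => /addrI.
by have := fB.2 x d y 0; rewrite /= !addr0 f0 addr0.
Qed.

(** By coassociativity [lw] touches only the left tensor factor, so it is a map of right
    comodules. *)
Lemma sw_left_winding a :
  \sum_(p <- sw hH (lw a)) f p.1 p.2 = \sum_(p <- sw hH a) f (lw p.1) p.2.
Proof.
rewrite left_windingE (linear_fun_sum _ _ (sw_linear hH fB)).
pose F x y z := (c x : k) *: f y z.
transitivity (\sum_(p <- sw hH a) \sum_(q <- sw hH p.2) F p.1 q.1 q.2).
  apply: eq_bigr => p _; rewrite /F -scaler_sumr.
  pose g : {linear H -> W} := HB.pack (fun a => \sum_(p <- sw hH a) f p.1 p.2)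
    (GRing.isLinear.Build _ _ _ _ _ (sw_linear hH fB)).
  exact: (linearZ_LR g).
rewrite -sw_coassoc; last first.
  split=> x y d u v; rewrite /F.
  - by rewrite linearP scalerDl scalerA.
  - by rewrite fB.1 scalerDr !scalerA mulrC.
  - by rewrite fB.2 scalerDr !scalerA mulrC.
apply: eq_bigr => p _; rewrite left_windingE.
rewrite (linear_fun_sum _ _ (fB.1 p.2)).
by apply: eq_bigr => q _; rewrite fZl.
Qed.

Lemma sw_right_winding a :
  \sum_(p <- sw hH (rw a)) f p.1 p.2 = \sum_(p <- sw hH a) f p.1 (rw p.2).
Proof.
rewrite right_windingE (linear_fun_sum _ _ (sw_linear hH fB)).
pose F x y z := (c z : k) *: f x y.
transitivity (\sum_(p <- sw hH a) \sum_(q <- sw hH p.1) F q.1 q.2 p.2).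
  apply: eq_bigr => p _; rewrite /F -scaler_sumr.
  pose g : {linear H -> W} := HB.pack (fun a => \sum_(p <- sw hH a) f p.1 p.2)
    (GRing.isLinear.Build _ _ _ _ _ (sw_linear hH fB)).
  exact: (linearZ_LR g).
rewrite sw_coassoc; last first.
  split=> x y d u v; rewrite /F.
  - by rewrite fB.1 scalerDr !scalerA mulrC.
  - by rewrite fB.2 scalerDr !scalerA mulrC.
  - by rewrite linearP scalerDl scalerA.
apply: eq_bigr => p _; rewrite right_windingE.
rewrite (linear_fun_sum _ _ (fB.2 p.1)).
by apply: eq_bigr => q _; rewrite fZr.
Qed.
End Bilinear.
End Functional.

Section Inverse.
Variables c d : {linear H -> k^o}.
Hypothesis cd : forall a, \sum_(p <- sw hH a) (c p.1 : k) * d p.2 = eps a.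

Let scaleBl : bilinear_fun (fun x y : H => (d x : k) *: y).
Proof.
split=> x b y z; first by rewrite linearP scalerDl scalerA.
by rewrite scalerDr !scalerA mulrC.
Qed.
Let scaleBr : bilinear_fun (fun x y : H => (c y : k) *: x).
Proof.
split=> x b y z; last by rewrite linearP scalerDl scalerA.
by rewrite scalerDr !scalerA mulrC.
Qed.

Lemma left_windingK : cancel (left_winding hH c) (left_winding hH d).
Proof.
move=> a; rewrite left_windingE (sw_left_winding _ scaleBl) -[RHS](counit_sw_l hH).
apply: eq_bigr => p _; congr (_ *: _); rewrite left_windingE linear_sum -cd.
by apply: eq_bigr => q _; rewrite linearZ.
Qed.

Lemma right_windingK : cancel (right_winding hH d) (right_winding hH c).
Proof.
move=> a; rewrite right_windingE (sw_right_winding _ scaleBr) -[RHS](counit_sw_r hH).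
apply: eq_bigr => p _; congr (_ *: _); rewrite right_windingE linear_sum -cd.
by apply: eq_bigr => q _; rewrite linearZ /= mulrC.
Qed.
End Inverse.

Section Character.
Variable chi : {lrmorphism H -> k^o}.
Local Notation cv := (conv hH).
Local Notation chiL := (chi : {linear H -> k^o}).
Local Notation chiS := [the {linear H -> k^o} of chi \o S].

Lemma char_antipode_r a : \sum_(p <- sw hH a) (chi p.1 : k) * chi (S p.2) = eps a.
Proof.
have := congr1 chi (antipode_sw_r hH a).
rewrite linear_sum linearZ rmorph1 [RHS]mulr1 => <-.
by apply: eq_bigr => p _; rewrite rmorphM.
Qed.

Lemma char_antipode_l a : \sum_(p <- sw hH a) (chi (S p.1) : k) * chi p.2 = eps a.
Proof.
have := congr1 chi (antipode_sw_l hH a).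
rewrite linear_sum linearZ rmorph1 [RHS]mulr1 => <-.
by apply: eq_bigr => p _; rewrite rmorphM.
Qed.

(** Makes a functional [H]-valued, so that it can be convolved with [idfun] and the antipode.
    Windings become convolutions of the identity with a map into central scalars. *)
Definition scalar_fun (c : H -> k^o) (a : H) : H := (c a : k)%:A.
Fact scalar_fun_linear (c : {linear H -> k^o}) : linear (scalar_fun c).
Proof. by move=> d x y; rewrite /scalar_fun linearP scalerDl scalerA. Qed.
HB.instance Definition _ (c : {linear H -> k^o}) :=
  GRing.isLinear.Build k H H *:%R (scalar_fun c) (scalar_fun_linear c).

Lemma scalar_funC c a x : scalar_fun c a * x = x * scalar_fun c a.
Proof. by rewrite /scalar_fun -scalerAl -scalerAr mul1r mulr1. Qed.

Lemma scalar_conv (c d : {linear H -> k^o}) :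
  (forall a, \sum_(p <- sw hH a) (c p.1 : k) * d p.2 = eps a) ->
  cv (scalar_fun c) (scalar_fun d) =1 convone hH H.
Proof.
move=> cd a; rewrite -[RHS]/((eps a : k)%:A) -cd scaler_suml; apply: eq_bigr => p _.
by rewrite /= /scalar_fun -scalerAl mul1r scalerA.
Qed.

(** [chi] and [chi \o S \o S] are a left and a right convolution inverse of the character
    [chi \o S]. *)
Lemma charSS a : chi (S (S a)) = chi a.
Proof.
have chiSS b : \sum_(p <- sw hH b) (chi (S p.1) : k) * chi (S (S p.2)) = eps b.
  have := congr1 (chi \o S) (antipode_sw_r hH b).
  rewrite /= !linear_sum !linearZ antipode1 rmorph1 [RHS]mulr1 => <-.
  by apply: eq_bigr => p _; rewrite antipodeM rmorphM mulrC.
pose c2 := [the {linear H -> k^o} of chi \o (S \o S)].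
have := conv_inv_unique (scalar_conv (c := chiL) (d := chiS) char_antipode_r)
  (scalar_conv (c := chiS) (d := c2) chiSS) a.
rewrite [LHS]/((chi a : k)%:A) [RHS]/((chi (S (S a)) : k)%:A) => /eqP.
by rewrite -subr_eq0 -scalerBl scaler_eq0 oner_eq0 orbF subr_eq0 => /eqP ->.
Qed.

Lemma left_winding_conv (c : {linear H -> k^o}) :
  left_winding hH c =1 cv (scalar_fun c) idH.
Proof.
move=> a; rewrite left_windingE; apply: eq_bigr => p _.
by rewrite /= /scalar_fun -scalerAl mul1r.
Qed.

Lemma right_winding_conv (c : {linear H -> k^o}) :
  right_winding hH c =1 cv idH (scalar_fun c).
Proof.
move=> a; rewrite right_windingE; apply: eq_bigr => p _.
by rewrite /= /scalar_fun -scalerAr mulr1.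
Qed.

Section Multiplicative.
Variable c : {linear H -> k^o}.
Hypotheses (cM : forall x y, c (x * y) = (c x : k) * c y) (c1 : c 1 = 1).

Let scM : {morph scalar_fun c : x y / x * y}.
Proof. by move=> x y; rewrite /scalar_fun cM -scalerAl mul1r scalerA. Qed.
Let sc1 : scalar_fun c 1 = 1.
Proof. by rewrite /scalar_fun c1 scale1r. Qed.

Lemma left_windingM : {morph left_winding hH c : x y / x * y}.
Proof.
move=> x y; rewrite !left_winding_conv.
by apply: conv_morph => // u v; rewrite scalar_funC.
Qed.
Lemma left_winding1 : left_winding hH c 1 = 1.
Proof. by rewrite left_winding_conv conv_one /= sc1 mulr1. Qed.
Lemma right_windingM : {morph right_winding hH c : x y / x * y}.
Proof.
move=> x y; rewrite !right_winding_conv.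
by apply: conv_morph => // u v; rewrite /= scalar_funC.
Qed.
Lemma right_winding1 : right_winding hH c 1 = 1.
Proof. by rewrite right_winding_conv conv_one /= sc1 mulr1. Qed.
End Multiplicative.

Let idM : {morph idH : x y / x * y}. Proof. by []. Qed.

Lemma chiSM x y : chiS (x * y) = (chiS x : k) * chiS y.
Proof. by rewrite /= antipodeM rmorphM mulrC. Qed.
Lemma chiS1 : chiS 1 = 1.
Proof. by rewrite /= antipode1 rmorph1. Qed.

Let Xchi := scalar_conv (c := (chi : {linear H -> k^o})) (d := chiS) char_antipode_r.

(** Both sides invert the algebra map [right_winding hH chiS] for convolution: this map is [id]
    convolved with [chiS], so [chi] convolved with [S] inverts it, and so does its own composite
    with [S]. *)
Lemma antipode_left_winding a :
  S (left_winding hH chi a) = right_winding hH chiS (S a).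
Proof.
pose f := [the {linear H -> H} of S \o left_winding hH (chi : {linear H -> k^o})].
pose g := [the {linear H -> H} of right_winding hH chiS].
pose h := [the {linear H -> H} of right_winding hH chiS \o S].
have fE : f =1 cv (scalar_fun (chi : {linear H -> k^o})) S.
  move=> b; rewrite /= left_windingE linear_sum; apply: eq_bigr => p _.
  by rewrite linearZ /scalar_fun -scalerAl mul1r.
apply: (@conv_inv_unique k H hH H f g h); last first.
  apply: (@conv_antipode_r k H hH H g).
    exact: (right_windingM chiSM).
  exact: (right_winding1 chiS1).
move=> b; rewrite (eq_conv hH fE (right_winding_conv chiS)) -convA -Xchi.
apply: eq_conv => // x.
  apply: etrans (convA hH _ _ _ x) _.
  apply: etrans _ (conv1f hH _ x); apply: eq_conv => // y.
exact: (conv_antipode_l hH idM erefl).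
Qed.

(** The mirror argument: both sides invert [left_winding hH chi], which is [chi] convolved with
    [id]. *)
Lemma left_winding_antipode a :
  left_winding hH chi (S a) = S (right_winding hH chiS a).
Proof.
pose f := [the {linear H -> H} of left_winding hH (chi : {linear H -> k^o}) \o S].
pose g := [the {linear H -> H} of left_winding hH (chi : {linear H -> k^o})].
pose h := [the {linear H -> H} of S \o right_winding hH chiS].
have hE : h =1 cv S (scalar_fun chiS).
  move=> b; rewrite /= right_windingE linear_sum; apply: eq_bigr => p _.
  by rewrite linearZ /scalar_fun -scalerAr mulr1.
apply: (@conv_inv_unique k H hH H f g h).
  apply: (@conv_antipode_l k H hH H g).
    by apply: left_windingM => x y; rewrite rmorphM.
  by apply: left_winding1; rewrite rmorph1.
move=> b; rewrite (eq_conv hH (left_winding_conv (chi : {linear H -> k^o})) hE).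
rewrite -convA -Xchi; apply: eq_conv => // x.
  apply: etrans (convA hH _ _ _ x) _.
  apply: etrans _ (conv1f hH _ x); apply: eq_conv => // y.
exact: (conv_antipode_r hH idM erefl).
Qed.

Lemma left_winding_antipode2 a :
  left_winding hH chi (S (S a)) = S (S (left_winding hH chi a)).
Proof. by rewrite left_winding_antipode -antipode_left_winding. Qed.
End Character.
End Winding.

(** * The enveloping algebra as a module over H *)

Section Functionals.
Variables (k : fieldType) (V : lmodType k).

(** A subspace [A] maximal among those avoiding [v] is a complement of the line of [v]; the
    functional reads off the coefficient of [v] modulo [A]. *)
Lemma exists_functional (v : V) : v != 0 -> exists f : {linear V -> k^o}, f v = 1.
Proof.
move=> v0.
(* [P] admits the empty set, since the union of the empty chain must satisfy it; this is why [B]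
   below allows [c = 0] as a separate case. *)
pose P (X : set V) := (forall a x y, X x -> X y -> X (a *: x + y)) /\ ~ X v.
have [|A [[Alin Av] Amax]] := @Zorn_bigcup V P.
  move=> F FP Ftot; split=> [a x y [X FX Xx] [Y FY Yy]|[X FX Xv]]; last first.
    by have [_] := FP X FX; exact.
  have [XY|YX] := Ftot X Y FX FY.
    by exists Y => //; apply: (FP Y FY).1 => //; exact: XY.
  by exists X => //; apply: (FP X FX).1 => //; exact: YX.
pose B x : set V := fun y => exists c b, (A c \/ c = 0) /\ y = c + b *: x.
have Asub x : (A `<=` B x)%classic.
  by move=> c Ac; exists c, 0; rewrite scale0r addr0; split=> //; left.
have Bin x : B x x by exists 0, 1; rewrite add0r scale1r; split=> //; right.
have Blin x a y z : B x y -> B x z -> B x (a *: y + z).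
  case=> c [b [Ac ->]] [c' [b' [Ac' ->]]].
  exists (a *: c + c'), (a * b + b'); split; last first.
    by rewrite scalerDr scalerDl scalerA addrACA.
  case: Ac Ac' => [Ac|->] [Ac'|->]; rewrite ?scaler0 ?add0r ?addr0.
  - by left; exact: Alin.
  - left; have A0 : A 0 by rewrite -(addNr c) -scaleN1r; exact: Alin.
    by rewrite -[_ *: _]addr0; exact: Alin.
  - by left.
  - by right.
have Bv x : ~ A x -> B x v.
  move=> Ax; apply: contrapT => Bxv; apply: (Amax (B x)).
    by split=> // BA; apply: Ax; exact: BA.
  by split=> // a y z; exact: Blin.
have A0 : A 0.
  apply: contrapT => /Bv[c [b [Ac]]]; rewrite scaler0 addr0 => vc.
  by case: Ac; rewrite -vc // => /eqP; rewrite (negPf v0).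
have AZ a x : A x -> A (a *: x) by move=> Ax; rewrite -[_ *: _]addr0; exact: Alin.
have /choice[f fP] : forall x, exists a : k, A (x - a *: v).
  move=> x; case: (pselect (A x)) => [Ax|/Bv[c [b [Ac vE]]]].
    by exists 0; rewrite scale0r subr0.
  have {}Ac : A c by case: Ac => // ->.
  have b0 : b != 0 by apply/eqP => b0; apply: Av; rewrite vE b0 scale0r addr0.
  exists b^-1; rewrite vE scalerDr scalerA mulVf // scale1r opprD addrCA subrr addr0.
  by rewrite -scalerN -scaleN1r; apply/AZ/AZ.
have funi x a : A (x - a *: v) -> f x = a.
  move=> xa; apply/eqP; rewrite -subr_eq0; apply: contraT => fa0; case: Av.
  have := Alin (-1) _ _ (fP x) xa; rewrite scaleN1r opprB addrA subrK -scalerBl.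
  by move=> /(AZ (f x - a)^-1); rewrite scalerA mulVf // scale1r.
have fL : linear (f : V -> k^o).
  move=> a x y; apply: funi.
  have := Alin a _ _ (fP x) (fP y); congr A.
  by rewrite scalerBr addrACA -opprD scalerDl scalerA.
pose g : {linear V -> k^o} := HB.pack (f : V -> k^o)
  (GRing.isLinear.Build _ _ _ _ (f : V -> k^o) fL).
by exists g; apply: funi; rewrite scale1r subrr.
Qed.

(** Stands in for a basis of [V]: a finite-rank operator fixing the given vectors. To fix one more
    vector [y], the operator [P] is corrected along [y - P y] by a functional that vanishes where
    [P] is already the identity. *)
Lemma finite_rank_identity (s : seq V) :
  exists (N : nat) (e : 'I_N -> V) (f : 'I_N -> {linear V -> k^o}),
    forall y, y \in s -> y = \sum_i (f i y : k) *: e i.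
Proof.
elim: s => [|y s [N [e [f efs]]]].
  by exists 0%N, (fun _ => 0), (fun _ => \0 : {linear V -> k^o}).
pose P x := \sum_i (f i x : k) *: e i.
have [yP|yP] := eqVneq (y - P y) 0.
  exists N, e, f => z; rewrite inE => /predU1P[->|]; last exact: efs.
  by apply/eqP; rewrite -subr_eq0 yP.
have [g gy] := exists_functional yP.
have hL : linear (fun x => g (x - P x)).
  move=> a x z; rewrite -linearP; congr (g _); rewrite scalerBr addrACA -opprD.
  congr (_ - _); rewrite /P scaler_sumr -big_split; apply: eq_bigr => i _ /=.
  by rewrite linearP scalerDl scalerA.
pose h : {linear V -> k^o} := HB.pack (fun x => g (x - P x))
  (GRing.isLinear.Build _ _ _ _ (fun x => g (x - P x)) hL).
exists N.+1, (fun i => if unlift ord0 i is Some j then e j else y - P y).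
exists (fun i => if unlift ord0 i is Some j then f j else h) => z.
rewrite inE big_ord_recl unlift_none.
under eq_bigr => i _ do rewrite liftK.
rewrite -/(P z) -[h z]/(g (z - P z)) => /predU1P[->|/efs zE].
  by rewrite gy scale1r subrK.
by rewrite -[P z]zE subrr linear0 scale0r add0r.
Qed.
End Functionals.

(* [R] is, via [i1] and [i2], the enveloping algebra of [H]: [i1 x * i2 y] plays
   the role of [x (x) y]. *)
Record enveloping (k : fieldType) (H R : algType k) (i1 i2 : {linear H -> R}) :
    Prop := Enveloping {
  env_mor1 : {morph i1 : x y / x * y};
  env_one1 : i1 1 = 1;
  env_mor2 : forall x y, i2 (x * y) = i2 y * i2 x;
  env_one2 : i2 1 = 1;
  env_comm : forall x y, i1 x * i2 y = i2 y * i1 x;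
  env_span : forall r, exists s : seq (H * H), r = \sum_(p <- s) i1 p.1 * i2 p.2;
  env_lift : forall (W : lmodType k) (f : H -> H -> W), bilinear_fun f ->
    exists F : {linear R -> W}, forall x y, F (i1 x * i2 y) = f x y
}.

Section Enveloping.
Variables (k : fieldType) (H : algType k) (hH : hopf_algebra H).
Variables (R : algType k) (i1 i2 : {linear H -> R}).
Hypothesis env : enveloping i1 i2.
Local Notation S := (antipode hH).
Local Notation eps := (counit hH).

Let i2S := [the {linear H -> R} of i2 \o S].
Let i2SM : {morph i2S : x y / x * y}.
Proof. by move=> x y; rewrite /= antipodeM (env_mor2 env). Qed.
Let i2S1 : i2S 1 = 1.
Proof. by rewrite /= antipode1 (env_one2 env). Qed.

Definition env_delta : {linear H -> R} := conv hH i1 i2S.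
Local Notation delta := env_delta.

Lemma env_deltaM : {morph delta : x y / x * y}.
Proof.
apply: conv_morph => //; first exact: (env_mor1 env).
by move=> x y; exact: (env_comm env).
Qed.

Lemma env_delta1 : delta 1 = 1.
Proof. by apply: etrans (conv_one hH i1 i2S) _; rewrite (env_one1 env) i2S1 mulr1. Qed.

Definition env_rmorph : {rmorphism H -> R} :=
  HB.pack (delta : H -> R)
    (GRing.isZmodMorphism.Build H R (delta : H -> R) (raddfB delta))
    (GRing.isMonoidMorphism.Build H R (delta : H -> R)
    (conj env_delta1 env_deltaM)).

(** Source of [S^2] in the twist: the algebra map [i2 \o S] has convolution inverse [i2 \o S \o S],
    and [delta] is [i1] convolved with [i2 \o S]. *)
Lemma env_i1E a : i1 a = \sum_(p <- sw hH a) delta p.1 * i2 (S (S p.2)).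
Proof.
pose i2SS := [the {linear H -> R} of i2S \o S].
rewrite -(convf1 hH i1); symmetry; apply: etrans (_ : conv hH delta i2SS a = _) _ => //.
rewrite -convA; apply: eq_conv => // x.
exact: (conv_antipode_r hH i2SM i2S1).
Qed.

(** With the [i2] factor on the left, the reversal of products by [i2] produces [S a_2 * a_3], which
    collapses without a further antipode. *)
Lemma env_i1E' a : i1 a = \sum_(p <- sw hH a) i2 p.2 * delta p.1.
Proof.
symmetry; transitivity (\sum_(p <- sw hH a) \sum_(q <- sw hH p.1)
    i1 q.1 * i2 (S q.2 * p.2)).
  apply: eq_bigr => p _; rewrite mulr_sumr; apply: eq_bigr => q _ /=.
  by rewrite (env_mor2 env) !mulrA (env_comm env).
rewrite (sw_coassoc hH (f := fun x y z => i1 x * i2 (S y * z))); last by trilinear.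
rewrite -{2}(counit_sw_r hH a) linear_sum; apply: eq_bigr => p _.
rewrite -mulr_sumr -linear_sum antipode_sw_l !linearZ /= (env_one2 env).
by rewrite -scalerAr mulr1.
Qed.

Lemma env_ind (P : R -> Prop) :
  P 0 -> (forall x y, P x -> P y -> P (x + y)) ->
  (forall x y, P (i1 x * i2 y)) -> forall r, P r.
Proof.
by move=> P0 PD P1 r; have [s ->] := env_span env r; elim/big_ind: _ => //.
Qed.

Lemma env_ind_l (P : R -> Prop) :
  P 0 -> (forall x y, P x -> P y -> P (x + y)) ->
  (forall h y, P (delta h * i2 y)) -> forall r, P r.
Proof.
move=> P0 PD P1; apply: env_ind => // x y.
rewrite env_i1E mulr_suml; elim/big_ind: _ => // p _.
by rewrite -mulrA -(env_mor2 env).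
Qed.

Lemma env_ind_r (P : R -> Prop) :
  P 0 -> (forall x y, P x -> P y -> P (x + y)) ->
  (forall h y, P (i2 y * delta h)) -> forall r, P r.
Proof.
move=> P0 PD P1; apply: env_ind => // x y.
rewrite (env_comm env) env_i1E' mulr_sumr; elim/big_ind: _ => // p _.
by rewrite mulrA -(env_mor2 env).
Qed.

(* The inverses of h (x) y |-> delta h * i2 y and h (x) y |-> i2 y * delta h are
   x (x) y |-> x_1 (x) y S^2(x_2) and x (x) y |-> x_1 (x) x_2 y; the coordinate
   maps apply [f] to their second factors. *)
Section Coordinates.
Variable f : {linear H -> k^o}.

Lemma env_coord_l : exists C : {linear R -> H},
  (forall h r, C (delta h * r) = h * C r) /\
  (forall h y, C (delta h * i2 y) = (f y : k) *: h).
Proof.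
pose F x y := \sum_(p <- sw hH x) (f (y * S (S p.2)) : k) *: p.1.
have FB : bilinear_fun F.
  split=> [y|x].
    apply: (sw_linear hH (f := fun a b => (f (y * S (S b)) : k) *: a)).
    split=> b d u v; first by rewrite scalerDr !scalerA mulrC.
    by rewrite !linearP mulrDr -scalerAr linearP scalerDl scalerA.
  apply: linear_fun_of_sum => p d u v.
  by rewrite mulrDl -scalerAl linearP scalerDl scalerA.
have [C CE] := env_lift env FB.
have Cd h y : C (delta h * i2 y) = (f y : k) *: h.
  rewrite mulr_suml linear_sum.
  transitivity (\sum_(p <- sw hH h) \sum_(q <- sw hH p.1)
      (f (y * (S p.2 * S (S q.2))) : k) *: q.1).
    apply: eq_bigr => p _; rewrite -mulrA -(env_mor2 env) CE.
    by apply: eq_bigr => q _; rewrite mulrA.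
  rewrite (sw_coassoc hH (f := fun a b c =>
    (f (y * (S c * S (S b))) : k) *: a)); last first.
    split=> b c d u v; first by rewrite scalerDr !scalerA mulrC.
      by rewrite !linearP !mulrDr -!scalerAr linearP scalerDl scalerA.
    by rewrite !linearP mulrDl mulrDr -scalerAl -scalerAr linearP scalerDl scalerA.
  rewrite -{2}(counit_sw_r hH h) scaler_sumr; apply: eq_bigr => p _.
  rewrite -scaler_suml -linear_sum -mulr_sumr.
  under eq_bigr => q _ do rewrite -antipodeM.
  rewrite -linear_sum antipode_sw_l linearZ /= antipode1 -scalerAr mulr1.
  by rewrite linearZ scalerA mulrC.
exists C; split=> // h; apply: env_ind_l => [|x y xE yE|g y].
- by rewrite mulr0 linear0 mulr0.
- by rewrite mulrDr !linearD xE yE mulrDr.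
- by rewrite mulrA -env_deltaM !Cd scalerAr.
Qed.

Lemma env_coord_r : exists C : {linear R -> H},
  (forall h r, C (r * delta h) = C r * h) /\
  (forall h y, C (i2 y * delta h) = (f y : k) *: h).
Proof.
pose F x y := \sum_(p <- sw hH x) (f (p.2 * y) : k) *: p.1.
have FB : bilinear_fun F.
  split=> [y|x].
    apply: (sw_linear hH (f := fun a b => (f (b * y) : k) *: a)).
    split=> b d u v; first by rewrite scalerDr !scalerA mulrC.
    by rewrite mulrDl -scalerAl linearP scalerDl scalerA.
  apply: linear_fun_of_sum => p d u v.
  by rewrite mulrDr -scalerAr linearP scalerDl scalerA.
have [C CE] := env_lift env FB.
have Cd h y : C (i2 y * delta h) = (f y : k) *: h.
  rewrite mulr_sumr linear_sum.
  transitivity (\sum_(p <- sw hH h) \sum_(q <- sw hH p.1)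
      (f (q.2 * S p.2 * y) : k) *: q.1).
    apply: eq_bigr => p _; rewrite mulrA -(env_comm env) -mulrA -(env_mor2 env) CE.
    by apply: eq_bigr => q _; rewrite mulrA.
  rewrite (sw_coassoc hH (f := fun a b c => (f (b * S c * y) : k) *: a)); last first.
    split=> b c d u v; first by rewrite scalerDr !scalerA mulrC.
      by rewrite !mulrDl -!scalerAl linearP scalerDl scalerA.
    by rewrite linearP mulrDr mulrDl -scalerAr -scalerAl linearP scalerDl scalerA.
  rewrite -{2}(counit_sw_r hH h) scaler_sumr; apply: eq_bigr => p _.
  rewrite -scaler_suml -linear_sum -mulr_suml antipode_sw_r -scalerAl mul1r.
  by rewrite linearZ scalerA mulrC.
exists C; split=> // h; apply: env_ind_r => [|x y xE yE|g y].
- by rewrite mul0r linear0 mul0r.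
- by rewrite mulrDl !linearD xE yE mulrDl.
- by rewrite -mulrA -env_deltaM !Cd scalerAl.
Qed.
End Coordinates.
End Enveloping.

(** * Cohomology of the resolution extended to the enveloping algebra *)

Lemma mulmx_scalar_sum (A : nzRingType) n (c : 'cV[A]_n) (T : Type) (s : seq T)
    (F : T -> A) :
  c *m (\sum_(x <- s) F x)%:M = \sum_(x <- s) c *m (F x)%:M.
Proof. by rewrite raddf_sum mulmx_sumr. Qed.

Section EnvelopingCohomology.
Variables (k : fieldType) (H : algType k) (hH : hopf_algebra H).
Variables (R : algType k) (i1 i2 : {linear H -> R}).
Hypothesis env : enveloping i1 i2.
Local Notation S := (antipode hH).
Local Notation eps := (counit hH).
Local Notation delta := (env_rmorph hH env).

Lemma env_delta_scalar (t : k) : delta (t%:A) = t%:A.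
Proof.
by apply: etrans (linearZ_LR (env_delta hH i1 i2) _ _) _; rewrite (env_delta1 hH env).
Qed.

(** Freeness over [delta(H)], restricted to finitely many elements. Left linear coordinates suit
    columns, which [delta]-matrices multiply on the left, hence cocycles; the right-hand version
    suits rows, hence exactness. *)
Lemma env_expand_l (s : seq R) :
  exists N (e : 'I_N -> H) (C : 'I_N -> {linear R -> H}),
    (forall i h r, C i (delta h * r) = h * C i r) /\
    (forall r, r \in s -> r = \sum_i delta (C i r) * i2 (e i)).
Proof.
have /choice[sp spE] : forall r, exists s' : seq (H * H),
    r = \sum_(p <- s') delta p.1 * i2 p.2.
  apply: (env_ind_l (hH := hH) env) => [|x y [s1 ->] [s2 ->]|h y].
  - by exists [::]; rewrite big_nil.
  - by exists (s1 ++ s2); rewrite big_cat.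
  - by exists [:: (h, y)]; rewrite big_seq1.
(* It suffices to reconstruct the second factors in the chosen presentations of the elements of
   [s]. *)
have [N [e [f efs]]] := finite_rank_identity (flatten [seq unzip2 (sp r) | r <- s]).
have /choice[C CE] := fun i => env_coord_l hH env (f i).
exists N, e, C; split=> [i|r rs]; first exact: (CE i).1.
have rE := spE r; set sr := sp r in rE; rewrite {1}rE big_seq.
have CrE i : delta (C i r) * i2 (e i) =
    \sum_(p <- sr) delta (C i (delta p.1 * i2 p.2)) * i2 (e i).
  by rewrite {1}rE linear_sum raddf_sum mulr_suml.
rewrite (eq_bigr _ (fun i _ => CrE i)) exchange_big big_seq; apply: eq_bigr => p ps /=.
rewrite {1}(efs p.2); last first.
  by apply/flatten_mapP; exists r => //; apply/mapP; exists p.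
rewrite linear_sum mulr_sumr; apply: eq_bigr => i _; rewrite (CE i).2.
by rewrite [in RHS](linearZ_LR (env_delta hH i1 i2)) linearZ -scalerAl -scalerAr.
Qed.

Lemma env_expand_r (s : seq R) :
  exists N (e : 'I_N -> H) (C : 'I_N -> {linear R -> H}),
    (forall i h r, C i (r * delta h) = C i r * h) /\
    (forall r, r \in s -> r = \sum_i i2 (e i) * delta (C i r)).
Proof.
have /choice[sp spE] : forall r, exists s' : seq (H * H),
    r = \sum_(p <- s') i2 p.2 * delta p.1.
  apply: (env_ind_r (hH := hH) env) => [|x y [s1 ->] [s2 ->]|h y].
  - by exists [::]; rewrite big_nil.
  - by exists (s1 ++ s2); rewrite big_cat.
  - by exists [:: (h, y)]; rewrite big_seq1.
have [N [e [f efs]]] := finite_rank_identity (flatten [seq unzip2 (sp r) | r <- s]).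
have /choice[C CE] := fun i => env_coord_r hH env (f i).
exists N, e, C; split=> [i|r rs]; first exact: (CE i).1.
have rE := spE r; set sr := sp r in rE; rewrite {1}rE big_seq.
have CrE i : i2 (e i) * delta (C i r) =
    \sum_(p <- sr) i2 (e i) * delta (C i (i2 p.2 * delta p.1)).
  by rewrite {1}rE linear_sum raddf_sum mulr_sumr.
rewrite (eq_bigr _ (fun i _ => CrE i)) exchange_big big_seq; apply: eq_bigr => p ps /=.
rewrite {1}(efs p.2); last first.
  by apply/flatten_mapP; exists r => //; apply/mapP; exists p.
rewrite linear_sum mulr_suml; apply: eq_bigr => i _; rewrite (CE i).2.
by rewrite [in RHS](linearZ_LR (env_delta hH i1 i2)) linearZ -scalerAl -scalerAr.
Qed.

(* The kernel of the multiplication map of [R]. *)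
Definition env_mul_ker (r : R) : Prop :=
  forall s : seq (H * H), r = \sum_(p <- s) i1 p.1 * i2 p.2 ->
  \sum_(p <- s) p.1 * p.2 = 0.

(** [delta h] acts between the two factors: [x (x) y] times [delta h] multiplies out to
    [x * h_1 * S h_2 * y]. Hence the left ideal generated by [delta] of the augmentation ideal lies
    in the kernel of [mu]. *)
Lemma env_mul : exists mu : {linear R -> H},
  (forall x y, mu (i1 x * i2 y) = x * y) /\
  (forall r h, mu (r * delta h) = (eps h : k) *: mu r).
Proof.
have [|mu muE] := env_lift env (f := fun x y => x * y); first by bilinear.
exists mu; split=> // r h; move: r; apply: (env_ind env) => [|x y xE yE|x y].
- by rewrite mul0r linear0 scaler0.
- by rewrite mulrDl !linearD xE yE.
rewrite mulr_sumr linear_sum muE.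
rewrite -[RHS]mulr1 -scalerAl mulr1 scalerAl.
transitivity (x * (\sum_(p <- sw hH h) p.1 * S p.2) * y); last first.
  by rewrite antipode_sw_r -scalerAr mulr1.
rewrite mulr_sumr mulr_suml; apply: eq_bigr => p _ /=.
rewrite -mulrA [i2 y * _]mulrA -(env_comm env) -mulrA mulrA -(env_mor1 env).
by rewrite -(env_mor2 env) muE !mulrA.
Qed.

Variables (r : nat -> nat) (D : matcomplex H r).
Hypothesis Deps : resolves D (fun a => eps a = 0).

Definition env_complex : matcomplex R r := fun i => map_mx delta (D i).
Local Notation ED := env_complex.

Lemma env_complex_resolves : resolves ED env_mul_ker.
Proof.
split=> [i v|a]; split.
- move=> vD.
  (* The coordinates commute with right multiplication by [delta]-matrices, so each coordinate row
     of [v] lies in the kernel of [D i] over [H]. *)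
  have [N [e [C [CM CE]]]] := env_expand_r [seq v 0 j | j <- enum 'I_(rk r i.+1)].
  have vE : v = \sum_j i2 (e j) *: map_mx delta (map_mx (C j) v).
    apply/matrixP => j l; rewrite (ord1 j) summxE {1}[v 0 l]CE; last first.
      by apply/mapP; exists l; rewrite ?mem_enum.
    by apply: eq_bigr => h _; rewrite !mxE.
  have /choice[w wE] : forall j, exists w, map_mx (C j) v = w *m D i.+1.
    move=> j; apply/(Deps.1 i); rewrite -[RHS](map_mx0 (C j)) -vD.
    apply/matrixP => x y; rewrite !mxE (raddf_sum (C j)); apply: eq_bigr => l _.
    by rewrite /env_complex !mxE; exact: esym (CM _ _ _).
  exists (\sum_j i2 (e j) *: map_mx delta (w j)); rewrite mulmx_suml {1}vE.
  by apply: eq_bigr => j _; rewrite wE map_mxM -scalemxAl.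
- case=> w ->; rewrite -mulmxA -map_mxM (resolves_sqr0 Deps) map_mx0 mulmx0 //.
- have [s ->] := env_span env a; move=> /(_ s erefl) s0.
  pose L a := exists w : 'rV_(rk r 1), a%:M = w *m ED 0.
  have LD x y : L x -> L y -> L (x + y).
    by move=> [u uE] [w wE]; exists (u + w); rewrite mulmxDl -uE -wE raddfD.
  have LM x y : L y -> L (x * y).
    by move=> [w wE]; exists (x *: w); rewrite -scalemxAl -wE scale_scalar_mx.
  have L0 : L 0 by exists 0; rewrite mul0mx raddf0.
  have Ld h : eps h = 0 -> L (delta h).
    case/(Deps.2 h)=> w wE; exists (map_mx delta w).
    by rewrite -map_mxM -wE map_scalar_mx.
  (* The subtracted terms sum to zero. Each difference is a left multiple of some [i1 a - i2 a],
     which lies in the left ideal generated by [delta] of the augmentation ideal. *)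
  have -> : \sum_(p <- s) i1 p.1 * i2 p.2 =
      \sum_(p <- s) (i1 p.1 * i2 p.2 - i2 (p.1 * p.2)).
    by rewrite sumrB -(raddf_sum i2) s0 raddf0 subr0.
  rewrite -/(L _); elim/big_ind: _ => // p _.
  rewrite (env_comm env) (env_mor2 env) -mulrBr; apply: (LM).
  have -> : i1 p.1 - i2 p.1 = \sum_(q <- sw hH p.1)
      i2 q.2 * delta (q.1 - (eps q.1 : k)%:A).
    rewrite (env_i1E' hH env) -{2}(counit_sw_l hH p.1) linear_sum -sumrB.
    apply: eq_bigr => q _; rewrite rmorphB mulrBr; congr (_ - _).
    by rewrite env_delta_scalar linearZ -scalerAr mulr1.
  elim/big_ind: _ => // q _; apply: (LM); apply: Ld.
  by rewrite linearB linearZ rmorph1 [X in _ - X]mulr1 subrr.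
- case=> w aE s sE; have [mu [muE mud]] := env_mul.
  transitivity (mu a); first by rewrite sE linear_sum; apply: eq_bigr => p _.
  have := congr1 (fun M : 'M_1 => M 0 0) aE; rewrite !mxE mulr1n => ->.
  rewrite (raddf_sum mu) big1 // => j _; rewrite /env_complex !mxE.
  apply: etrans (mud _ _) _; suff -> : eps (D 0 j 0) = 0 by rewrite scale0r.
  by apply/(Deps.2); exists 'e_j; rewrite -rowE [RHS]mx11_scalar mxE.
Qed.

Variables (n : nat) (z : 'cV[H]_(rk r n)).
Hypotheses (Dz : D n *m z = 0) (zB : ~ mcoboundary D z).
Local Notation zR := (map_mx delta z).

Lemma env_coboundary (c : 'cV[H]_(rk r n)) :
  mcoboundary D c -> mcoboundary ED (map_mx delta c).
Proof.
case: n c => [|m] c; first by move=> ->; rewrite map_mx0.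
by case=> g ->; exists (map_mx delta g); rewrite map_mxM.
Qed.

Lemma env_cocycle : ED n *m zR = 0.
Proof. by rewrite /env_complex -map_mxM Dz map_mx0. Qed.

(** The coordinate columns of a cocycle are cocycles over [H], hence scalar multiples of [z] up to
    coboundaries; the scalars gather into [y]. *)
Lemma env_cocycle_span :
  (forall c, D n *m c = 0 ->
     exists t : k, mcoboundary D (c - z *m ((t%:A : H)%:M))) ->
  forall c, ED n *m c = 0 -> exists y, mcoboundary ED (c - zR *m (i2 y)%:M).
Proof.
move=> zspan c Dc.
have [N [e [C [CM CE]]]] := env_expand_l [seq c j 0 | j <- enum 'I_(rk r n)].
have cE : c = \sum_j map_mx delta (map_mx (C j) c) *m (i2 (e j))%:M.
  apply/matrixP => j l; rewrite (ord1 l) summxE {1}[c j 0]CE; last first.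
    by apply/mapP; exists j; rewrite ?mem_enum.
  by apply: eq_bigr => h _; rewrite mulmx_scalar11 !mxE.
have /choice[t tE] : forall j, exists t : k,
    mcoboundary D (map_mx (C j) c - z *m ((t%:A : H)%:M)).
  move=> j; apply: zspan; rewrite -[RHS](map_mx0 (C j)) -Dc.
  apply/matrixP => x y; rewrite !mxE (raddf_sum (C j)); apply: eq_bigr => l _.
  by rewrite /env_complex !mxE; exact: esym (CM _ _ _).
exists (\sum_j t j *: e j); rewrite {1}cE linear_sum raddf_sum mulmx_sumr -sumrB.
apply: mcoboundary_sum => j.
have := mcoboundaryM (i2 (e j))%:M (env_coboundary (tE j)).
rewrite map_mxB map_mxM map_scalar_mx mulmxBl -mulmxA -scalar_mxM.
by rewrite [delta _]env_delta_scalar -scalerAl mul1r linearZ.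
Qed.

(** If [y] is nonzero, the coordinate map of a functional with value 1 at [y] recovers [z] and
    preserves coboundaries. *)
Lemma env_cocycle_free y : mcoboundary ED (zR *m (i2 y)%:M) -> y = 0.
Proof.
move=> yB; apply/eqP; apply: contraT => /exists_functional[f fy]; case: zB.
have [C [CM CE]] := env_coord_l hH env f.
have Cz : map_mx C (zR *m (i2 y)%:M) = z.
  apply/matrixP => i j; rewrite !mxE (ord1 j) big_ord1 !mxE mulr1n.
  by rewrite CE fy scale1r.
move: yB; rewrite -{2}Cz; case: (n) (zR *m _) => [|m] c /=.
  by move=> ->; rewrite map_mx0.
case=> g ->; exists (map_mx C g); apply/matrixP => i j.
rewrite !mxE (raddf_sum C); apply: eq_bigr => l _.
by rewrite /env_complex !mxE; exact: (CM _ _).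
Qed.

(** Expanding [i1 a] as [delta a_1 * i2 (S^2 a_2)], the first factor acts on [z] through [chi],
    which leaves [S^2] of the left winding. *)
Lemma env_cocycle_i1 (chi : {linear H -> k^o}) :
  (forall a, mcoboundary D (z *m a%:M - z *m ((chi a : k)%:A : H)%:M)) ->
  forall a, mcoboundary ED
    (zR *m (i1 a)%:M - zR *m (i2 (S (S (left_winding hH chi a))))%:M).
Proof.
move=> zchi a.
rewrite (env_i1E hH env) left_windingE 3!linear_sum !mulmx_scalar_sum -sumrB.
apply: mcoboundary_sum => p.
have := mcoboundaryM (i2 (S (S p.2)))%:M (env_coboundary (zchi p.1)).
rewrite map_mxB !map_mxM !map_scalar_mx mulmxBl -!mulmxA -!scalar_mxM.
by rewrite [delta _%:A]env_delta_scalar -scalerAl mul1r !linearZ.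
Qed.
End EnvelopingCohomology.

(** * Tensor algebras and the opposite Hopf algebra *)

Section TensorAlgebra.
Variables (k : fieldType) (A B : algType k).

Definition tensalg : Type := tensor A B.
HB.instance Definition _ := GRing.Lmodule.copy tensalg (tensor A B).

Let tensalg_one : tensalg := tens 1 1.
Let tensalg_mul (s t : tensalg) : tensalg := tensmul s t.

Let tensalg_mulDl : left_distributive tensalg_mul +%R.
Proof.
move=> s t u; have := (@tensmul_bilinear k A B).1 u 1 s t.
by rewrite !scale1r.
Qed.

Let tensalg_mulDr : right_distributive tensalg_mul +%R.
Proof.
move=> s t u; have := (@tensmul_bilinear k A B).2 s 1 t u.
by rewrite !scale1r.
Qed.

Let mul0T t : tensalg_mul 0 t = 0.
Proof.
by have := tensalg_mulDl 0 0 t; rewrite addr0 -[LHS]addr0 => /addrI.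
Qed.

Let mulT0 t : tensalg_mul t 0 = 0.
Proof.
by have := tensalg_mulDr t 0 0; rewrite addr0 -[LHS]addr0 => /addrI.
Qed.

Let scaleTl (a : k) (s t : tensalg) : a *: tensalg_mul s t = tensalg_mul (a *: s) t.
Proof.
have := (@tensmul_bilinear k A B).1 t a s 0; rewrite /= !addr0 => E.
apply: esym; apply: etrans E _.
by rewrite -[tensmul 0 t]/(tensalg_mul 0 t) mul0T addr0.
Qed.

Let scaleTr (a : k) (s t : tensalg) : a *: tensalg_mul s t = tensalg_mul s (a *: t).
Proof.
have := (@tensmul_bilinear k A B).2 s a t 0; rewrite /= !addr0 => E.
apply: esym; apply: etrans E _.
by rewrite -[tensmul s 0]/(tensalg_mul s 0) mulT0 addr0.
Qed.

Let tensalg_ind (P : tensalg -> Prop) :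
  P 0 -> (forall s t, P s -> P t -> P (s + t)) -> (forall a s, P s -> P (a *: s)) ->
  (forall a b, P (tens a b)) -> forall t, P t.
Proof.
move=> P0 PD PZ P1 t; have [s [c ->]] := tensor_span t.
by elim/big_ind: _ => // p _; apply: PZ.
Qed.

Let tensalg_mulA : associative tensalg_mul.
Proof.
move=> s t u; elim/tensalg_ind: s => [|s s' E E'|a s E|a b].
- by rewrite !mul0T.
- by rewrite !tensalg_mulDl E E'.
- by rewrite -!scaleTl E.
elim/tensalg_ind: t => [|s s' E E'|e s E|c d].
- by rewrite !(mul0T, mulT0).
- by rewrite !(tensalg_mulDl, tensalg_mulDr) E E'.
- by rewrite -!(scaleTl, scaleTr) E.
elim/tensalg_ind: u => [|s s' E E'|e' s E|e f].
- by rewrite !mulT0.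
- by rewrite !tensalg_mulDr E E'.
- by rewrite -!scaleTr E.
by rewrite /tensalg_mul !tensmulE !mulrA.
Qed.

Let tensalg_mul1 : left_id tensalg_one tensalg_mul.
Proof.
elim/tensalg_ind=> [|s s' E E'|a s E|a b].
- by rewrite mulT0.
- by rewrite tensalg_mulDr E E'.
- by rewrite -scaleTr E.
by rewrite /tensalg_mul tensmulE !mul1r.
Qed.

Let tensalg_mulr1 : right_id tensalg_one tensalg_mul.
Proof.
elim/tensalg_ind=> [|s s' E E'|a s E|a b].
- by rewrite mul0T.
- by rewrite tensalg_mulDl E E'.
- by rewrite -scaleTl E.
by rewrite /tensalg_mul tensmulE !mulr1.
Qed.

Let tensalg_one_neq0 : tensalg_one != 0.
Proof.
have [f f1] := exists_functional (oner_neq0 A).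
have [g g1] := exists_functional (oner_neq0 B).
pose h (a : A) (b : B) : k^o := (f a : k) * g b.
have [hl hr] : bilinear_fun h.
  split=> [b|a] c x y; rewrite /h linearP ?mulrDl ?mulrDr; congr (_ + _).
    exact: esym (scalerAl _ _ _).
  exact: esym (scalerAr _ _ _).
apply/eqP => /(congr1 (tlift h)); rewrite (tliftE hl hr) /h f1 g1 mulr1.
have := tlift_linear hl hr 1 0 0; rewrite !scale1r addr0 -[LHS]addr0 => /addrI <- /eqP.
by rewrite oner_eq0.
Qed.

HB.instance Definition _ := GRing.Zmodule_isNzRing.Build tensalg
  tensalg_mulA tensalg_mul1 tensalg_mulr1 tensalg_mulDl tensalg_mulDr
  tensalg_one_neq0.
HB.instance Definition _ := GRing.Lmodule_isLalgebra.Build k tensalg scaleTl.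
HB.instance Definition _ := GRing.Lalgebra_isAlgebra.Build k tensalg scaleTr.

Lemma tensalgM (a c : A) (b d : B) :
  (tens a b : tensalg) * (tens c d : tensalg) = tens (a * c) (b * d).
Proof. exact: tensmulE. Qed.
End TensorAlgebra.

Section EnvelopingAlgebra.
Variables (k : fieldType) (H : algType k).
Local Notation R := (tensalg H H^c).

Definition env_in1 (x : H) : R := tens x (1 : H^c).
Definition env_in2 (y : H) : R := tens (1 : H) (y : H^c).

Fact env_in1_linear : linear env_in1.
Proof. exact: tens_linear_l. Qed.
Fact env_in2_linear : linear env_in2.
Proof. move=> a y z; exact: (@tens_linear_r k H H^c 1 a y z). Qed.
HB.instance Definition _ := GRing.isLinear.Build k H R *:%R env_in1 env_in1_linear.
HB.instance Definition _ := GRing.isLinear.Build k H R *:%R env_in2 env_in2_linear.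

Lemma env_in12 (x y : H) : env_in1 x * env_in2 y = tens x (y : H^c).
Proof. by rewrite /env_in1 /env_in2 tensalgM mulr1 mul1r. Qed.

Lemma enveloping_tensor :
  enveloping (env_in1 : {linear H -> R}) (env_in2 : {linear H -> R}).
Proof.
split=> //.
- by move=> x y; rewrite /env_in1 tensalgM mulr1.
- by move=> x y; rewrite /env_in2 tensalgM mulr1.
- by move=> x y; rewrite env_in12 /env_in1 /env_in2 tensalgM mulr1 mul1r.
- move=> r; have [s [c ->]] := tensor_span r.
  exists [seq (c p *: p.1, p.2) | p <- s]; rewrite big_map; apply: eq_bigr => p _.
  by rewrite [in RHS]/= (linearZ_LR env_in1) -scalerAl env_in12.
- move=> W f [fl fr]; pose g (x : H) (y : H^c) : W := f x y.
  have gl (y : H^c) : linear (g^~ y) by exact: fl.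
  have gr (x : H) : linear (g x) by exact: fr.
  pose F : {linear R -> W} := HB.pack (tlift g : R -> W)
    (GRing.isLinear.Build k R W *:%R (tlift g : R -> W) (tlift_linear gl gr)).
  by exists F => x y; rewrite env_in12; exact: (tliftE gl gr).
Qed.
(* Hides the construction, which makes conversion tests on [R] expensive. *)
Lemma enveloping_exists :
  exists (R' : algType k) (i1 i2 : {linear H -> R'}), enveloping i1 i2.
Proof. by exists R, env_in1, env_in2; exact: enveloping_tensor. Qed.
End EnvelopingAlgebra.

(** * The opposite and coopposite Hopf algebra *)

Section Opposite.
Variables (k : fieldType) (H : algType k) (hH : hopf_algebra H).

Definition conv_linear_fun (W : lmodType k) (f : H -> W) : H^c -> W := f.
Fact conv_linear_fun_linear (W : lmodType k) (f : {linear H -> W}) :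
  linear (conv_linear_fun f).
Proof. exact: linearP f. Qed.
HB.instance Definition _ (W : lmodType k) (f : {linear H -> W}) :=
  GRing.isLinear.Build k H^c W *:%R (conv_linear_fun f) (conv_linear_fun_linear f).

(** The same [R] serves both computations, so the two extended complexes can be compared
    directly. *)
Lemma enveloping_opposite (R : algType k) (i1 i2 : {linear H -> R}) :
  enveloping i1 i2 ->
  enveloping (conv_linear_fun i2 : {linear H^c -> R})
             (conv_linear_fun i1 : {linear H^c -> R}).
Proof.
case=> m1 o1 m2 o2 cm sp lf; split=> //.
- by move=> x y; exact: m2.
- by move=> x y; exact: m1.
- by move=> x y; exact: esym (cm y x).
- move=> r; have [s ->] := sp r; exists [seq (p.2, p.1) | p <- s].
  by rewrite big_map; apply: eq_bigr => p _; exact: cm.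
- move=> W f [fl fr]; have [|F FE] := lf W (fun x y => f y x).
    by split=> x; [exact: fr|exact: fl].
  by exists F => x y; rewrite -[RHS]FE cm.
Qed.

Definition opcop (a : H^c) : tensor H^c H^c :=
  tlift (fun x y : H => tens (y : H^c) (x : H^c)) (comul hH a).

Let swapB : bilinear_fun (fun x y : H => tens (y : H^c) (x : H^c)).
Proof.
split=> x a y z; first exact: (@tens_linear_r k H^c H^c x a y z).
exact: (@tens_linear_l k H^c H^c x a y z).
Qed.

Fact opcop_linear : linear opcop.
Proof.
by move=> a x y; rewrite /opcop linearP (tlift_linear swapB.1 swapB.2).
Qed.
HB.instance Definition _ :=
  GRing.isLinear.Build k H^c (tensor H^c H^c) *:%R opcop opcop_linear.

Lemma opcopE a : opcop a = \sum_(p <- sw hH a) tens (p.2 : H^c) (p.1 : H^c).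
Proof. exact: (tlift_sw hH swapB). Qed.

Lemma tlift_opcop (W : lmodType k) (f : H^c -> H^c -> W) a : bilinear_fun f ->
  tlift f (opcop a) = \sum_(p <- sw hH a) f p.2 p.1.
Proof.
case=> fl fr; rewrite opcopE (linear_fun_sum _ _ (tlift_linear fl fr)).
by apply: eq_bigr => p _; rewrite tliftE.
Qed.

Definition conv_antipode : H^c -> H^c := antipode hH.
Fact conv_antipode_linear : linear conv_antipode.
Proof. exact: linearP (antipode hH). Qed.
HB.instance Definition _ :=
  GRing.isLinear.Build k H^c H^c *:%R conv_antipode conv_antipode_linear.

Definition conv_counit : H^c -> k^o := counit hH.
Fact conv_counit_linear : linear conv_counit.
Proof. exact: linearP (counit hH). Qed.
Fact conv_counit_monoid : monoid_morphism conv_counit.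
Proof. exact: conv_fun_monoid (counit hH). Qed.
HB.instance Definition _ :=
  GRing.isLinear.Build k H^c k^o *:%R conv_counit conv_counit_linear.
HB.instance Definition _ :=
  GRing.isMonoidMorphism.Build H^c k^o conv_counit conv_counit_monoid.

Let opcop_assoc a :
  tassoc (tmap opcop id (opcop a)) = tmap id opcop (opcop a).
Proof.
pose idL : {linear H^c -> H^c} := [the {linear H^c -> H^c} of idfun].
pose opL : {linear H^c -> tensor H^c H^c} := opcop.
rewrite opcopE.
rewrite (linear_fun_sum _ _ (tmap_linear opL idL)).
rewrite (linear_fun_sum _ _ (tmap_linear idL opL)).
rewrite (linear_fun_sum _ _ (@tassoc_linear k H^c H^c H^c)).
pose f (x y z : H) : tensor H^c (tensor H^c H^c) :=
  tens (z : H^c) (tens (y : H^c) (x : H^c)).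
transitivity (\sum_(p <- sw hH a) \sum_(q <- sw hH p.2) f p.1 q.1 q.2).
  apply: eq_bigr => p _; rewrite (tmapE opL idL) /= opcopE.
  have tl := tens_linear_l (U := tensor H^c H^c) (p.1 : H^c).
  rewrite (linear_fun_sum _ _ tl).
  rewrite (linear_fun_sum _ _ (@tassoc_linear k H^c H^c H^c)).
  by apply: eq_bigr => q _; rewrite tassocE.
rewrite -sw_coassoc; last first.
  split=> x y c u v; rewrite /f.
  - by rewrite !tens_linear_r.
  - by rewrite tens_linear_l tens_linear_r.
  - by rewrite tens_linear_l.
apply: eq_bigr => p _; rewrite (tmapE idL opL) /= opcopE.
have tr := tens_linear_r (V := tensor H^c H^c) (p.2 : H^c).
by rewrite (linear_fun_sum _ _ tr).
Qed.

Let opcop_counit_l a :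
  tlift (fun x y => (conv_counit x : k) *: y) (opcop a) = a.
Proof.
rewrite tlift_opcop; first exact: (counit_sw_r hH).
split=> x c y z; first by rewrite linearP scalerDl scalerA.
by rewrite scalerDr !scalerA mulrC.
Qed.

Let opcop_counit_r a :
  tlift (fun x y => (conv_counit y : k) *: x) (opcop a) = a.
Proof.
rewrite tlift_opcop; first exact: (counit_sw_l hH).
split=> x c y z; last by rewrite linearP scalerDl scalerA.
by rewrite scalerDr !scalerA mulrC.
Qed.

Let opcop1 : opcop 1 = tens 1 1.
Proof. by rewrite opcopE (sw1 hH swapB). Qed.

Let opcopM a b : opcop (a * b) = tmul (opcop a) (opcop b).
Proof.
rewrite -[RHS]/(tensmul _ _) opcopE (swM hH swapB) !opcopE exchange_big.
rewrite (linear_fun_sum _ _ ((@tensmul_bilinear k H^c H^c).1 _)).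
apply: eq_bigr => p _.
rewrite (linear_fun_sum _ _ ((@tensmul_bilinear k H^c H^c).2 _)).
by apply: eq_bigr => q _; rewrite tensmulE.
Qed.

Let opcop_antipode_l a :
  tlift (fun x y => conv_antipode x * y) (opcop a) = (conv_counit a : k)%:A.
Proof. by rewrite tlift_opcop; [exact: (antipode_sw_r hH)|bilinear]. Qed.

Let opcop_antipode_r a :
  tlift (fun x y => x * conv_antipode y) (opcop a) = (conv_counit a : k)%:A.
Proof. by rewrite tlift_opcop; [exact: (antipode_sw_l hH)|bilinear]. Qed.

(** Reversing product and coproduct together keeps [S] as antipode; reversing only one of them would
    require its inverse. *)
Definition hopf_opcop : hopf_algebra H^c :=
  @HopfAlgebra k H^c opcop conv_counit conv_antipode opcop_assoc
    opcop_counit_l opcop_counit_r opcop1 opcopM opcop_antipode_l opcop_antipode_r.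

Lemma left_winding_opcop (c : {linear H -> k^o}) (a : H) :
  left_winding hopf_opcop (c : H^c -> k) a = right_winding hH c a.
Proof.
rewrite right_windingE /left_winding tlift_opcop //.
split=> x d y z; first by rewrite [c _](linearP c) scalerDl scalerA.
by rewrite scalerDr !scalerA mulrC.
Qed.
End Opposite.

(** * Comparison of the two bimodule resolutions *)

Lemma eq_resolves (A : nzRingType) r (D : matcomplex A r) (I J : A -> Prop) :
  (forall a, I a <-> J a) -> resolves D I -> resolves D J.
Proof. by move=> IJ [Dex DI]; split=> // a; rewrite -IJ. Qed.

(* The class of [z] is a [k]-basis of the Ext group computed by [D] in degree [n]. *)
Definition generates_cohomology (k : fieldType) (A : algType k) r
    (D : matcomplex A r) n (z : 'cV[A]_(rk r n)) : Prop :=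
  [/\ D n *m z = 0, ~ mcoboundary D z
    & forall c, D n *m c = 0 ->
        exists t : k, mcoboundary D (c - z *m ((t%:A : A)%:M))].

(** * Transport of a resolution along a ring isomorphism *)

Section Transport.
Variables (A B : nzRingType) (f : {rmorphism A -> B}) (g : B -> A).
Hypotheses (fK : cancel f g) (gK : cancel g f).
Variables (r : nat -> nat) (D : matcomplex A r).

Let fmx_inj m n : injective (map_mx f : 'M_(m, n) -> 'M_(m, n)).
Proof.
move=> M N MN; apply/matrixP => i j; apply: (can_inj fK).
by have /matrixP/(_ i j) := MN; rewrite !mxE.
Qed.

Let fmxK m n (M : 'M[B]_(m, n)) : map_mx f (map_mx g M) = M.
Proof. by apply/matrixP => i j; rewrite !mxE gK. Qed.

Definition map_complex : matcomplex B r := fun i => map_mx f (D i).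

Lemma map_resolves I : resolves D I -> resolves map_complex (I \o g).
Proof.
move=> DI; split=> [i v|a]; split.
- rewrite -[v]fmxK /map_complex -map_mxM -(map_mx0 f) => /fmx_inj/(DI.1 i)[w wE].
  by exists (map_mx f w); rewrite wE map_mxM.
- by case=> w ->; rewrite -mulmxA -map_mxM (resolves_sqr0 DI) map_mx0 mulmx0.
- move=> /(DI.2 (g a))[w wE]; exists (map_mx f w).
  by rewrite -map_mxM -wE map_scalar_mx /= gK.
- case=> w wE; apply/(DI.2 (g a)); exists (map_mx g w); apply: fmx_inj.
  by rewrite map_mxM fmxK -[map_mx f (D 0)]/(map_complex 0) -wE map_scalar_mx /= gK.
Qed.

Lemma map_coboundary n (c : 'cV[A]_(rk r n)) :
  mcoboundary map_complex (map_mx f c) <-> mcoboundary D c.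
Proof.
case: n c => [|n] c.
  by split=> [|->]; [rewrite /= -(map_mx0 f) => /fmx_inj|exact: map_mx0].
split=> [[h]|[h ->]]; last by exists (map_mx f h); rewrite map_mxM.
by rewrite -[h]fmxK -map_mxM => /fmx_inj ->; exists (map_mx g h).
Qed.
End Transport.

Section Comparison.
Variables (k : fieldType) (H : algType k) (hH : hopf_algebra H).
Variables (R : algType k) (i1 i2 : {linear H -> R}).
Hypothesis env : enveloping i1 i2.
Variables (r : nat -> nat) (D : matcomplex H r) (n : nat) (z : 'cV[H]_(rk r n)).
Hypothesis Deps : resolves D (fun a => counit hH a = 0).
Hypothesis zgen : generates_cohomology D z.
Variable chi : {linear H -> k^o}.
Hypothesis zchi : forall a,
  mcoboundary D (z *m a%:M - z *m ((chi a : k)%:A : H)%:M).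
Variables (s : nat -> nat) (E : matcomplex H^c s) (w : 'cV[H^c]_(rk s n)).
Hypothesis Eeps : resolves E (fun a => counit (hopf_opcop hH) a = 0).
Hypothesis wgen : @generates_cohomology k H^c s E n w.

Local Notation S := (antipode hH).
Local Notation hK := (hopf_opcop hH).
Local Notation envK := (enveloping_opposite env).
Local Notation ED := (env_complex hH env D).
Local Notation EE := (env_complex hK envK E).
Local Notation zR := (map_mx (env_rmorph hH env) z).
Local Notation wR := (map_mx (env_rmorph hK envK) w).
Local Notation sigma a := (S (S (left_winding hH chi a))).

Lemma env_mul_ker_opposite (a : R) :
  env_mul_ker i1 i2 a <->
  env_mul_ker (conv_linear_fun i2 : {linear H^c -> R})
              (conv_linear_fun i1 : {linear H^c -> R}) a.
Proof.
split=> aP l lE.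
  have := aP [seq (p.2, p.1) | p <- l]; rewrite !big_map; apply.
  by rewrite lE; apply: eq_bigr => p _; rewrite (env_comm env).
have := aP [seq (p.2, p.1) | p <- l]; rewrite !big_map; apply.
by rewrite lE; apply: eq_bigr => p _; rewrite (env_comm env).
Qed.

(** [u] is the coordinate, relative to [zR], of the transported generator [F n *m wR]. On it [i1 x]
    gives the coordinate [u * sigma x] and [i2 a] gives [a * u]. Since [tau] is quantified inside,
    the first two clauses are usable before any right-hand twist is known. *)
Lemma env_comparison : exists u : H,
  [/\ forall y, exists x, y = u * sigma x,
      forall x, u * sigma x = 0 -> x = 0
    & forall tau : H -> H,
        (forall a, mcoboundary EE (wR *m (i2 a)%:M - wR *m (i1 (tau a))%:M)) ->
        forall a, a * u = u * sigma (tau a)].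
Proof.
have [Dz zB zspan] := zgen; have [Ew wB wspan] := wgen.
have EDr := env_complex_resolves env Deps.
have EEr : resolves EE (env_mul_ker i1 i2).
  apply: eq_resolves (env_complex_resolves envK Eeps) => a.
  by rewrite env_mul_ker_opposite.
have [F F0 FE] := matrix_chain_map EDr EEr.
have [G G0 GE] := matrix_chain_map EEr EDr.
have FG := matrix_homotopy EDr F0 G0 FE GE.
have GF := matrix_homotopy EEr G0 F0 GE FE.
have Fcob (c : 'cV_(rk s n)) : mcoboundary EE c -> mcoboundary ED (F n *m c).
  case: (n) c => [|m] c; first by move=> ->; exact: mulmx0.
  by case=> g ->; exists (F m *m g); rewrite !mulmxA FE.
have Gcob (c : 'cV_(rk r n)) : mcoboundary ED c -> mcoboundary EE (G n *m c).
  case: (n) c => [|m] c; first by move=> ->; exact: mulmx0.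
  by case=> g ->; exists (G m *m g); rewrite !mulmxA GE.
have Fcoc (c : 'cV_(rk s n)) : EE n *m c = 0 -> ED n *m (F n *m c) = 0.
  by move=> c0; rewrite mulmxA -FE -mulmxA c0 mulmx0.
have Gcoc (c : 'cV_(rk r n)) : ED n *m c = 0 -> EE n *m (G n *m c) = 0.
  by move=> c0; rewrite mulmxA -GE -mulmxA c0 mulmx0.
pose eqv (c d : 'cV[R]_(rk r n)) := mcoboundary ED (c - d).
have eqvT c d e : eqv c d -> eqv d e -> eqv c e.
  by move=> cd de; have := mcoboundaryD cd de; rewrite addrA subrK.
have eqvS c d : eqv c d -> eqv d c.
  move=> cd; rewrite /eqv -opprB -[- (c - d)]sub0r.
  by apply: mcoboundaryB cd; exact: mcoboundary0.
have eqvM c d (a : R) : eqv c d -> eqv (c *m a%:M) (d *m a%:M).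
  by move=> cd; rewrite /eqv -mulmxBl; exact: mcoboundaryM.
have wRc := env_cocycle hK envK Ew; have zRc := env_cocycle hH env Dz.
have [u uE] := env_cocycle_span zspan (Fcoc _ wRc).
have free y y' : eqv (zR *m (i2 y)%:M) (zR *m (i2 y')%:M) -> y = y'.
  rewrite /eqv -mulmxBr -raddfB -linearB => /(env_cocycle_free zB)/eqP.
  by rewrite subr_eq0 => /eqP.
have Fw_i1 x : eqv (F n *m wR *m (i1 x)%:M) (zR *m (i2 (u * sigma x))%:M).
  apply: (eqvT _ _ _ (eqvM _ _ _ uE)).
  rewrite -mulmxA -scalar_mxM -(env_comm env) scalar_mxM mulmxA.
  rewrite (env_mor2 env) scalar_mxM [X in eqv _ X]mulmxA; apply: (eqvM).
  exact: env_cocycle_i1.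
have Fw_i2 a : eqv (F n *m wR *m (i2 a)%:M) (zR *m (i2 (a * u))%:M).
  by rewrite (env_mor2 env) scalar_mxM [X in eqv _ X]mulmxA; exact: eqvM.
exists u; split=> [y|x ux0|tau tauE a].
- pose c := zR *m (i2 y)%:M.
  have cc : ED n *m c = 0 by rewrite mulmxA zRc mul0mx.
  (* In the opposite computation [i1] plays the part of [i2], so the pullback of [c] is [wR] times
     some [i1 x]. *)
  have [x xE] := env_cocycle_span wspan (Gcoc _ cc).
  exists x; apply: (free); apply: (eqvT) (Fw_i1 x).
  apply: (eqvT) (eqvS _ _ (FG n c cc)) _.
  by have := Fcob _ xE; rewrite mulmxBr [F n *m (wR *m _)]mulmxA.
(* Freeness of [wR] over [i1], applied after returning along [G]. *)
- have := Fw_i1 x; rewrite ux0 linear0 raddf0 mulmx0 /eqv subr0 => /Gcob.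
  have wx : EE n *m (wR *m (i1 x)%:M) = 0 by rewrite mulmxA wRc mul0mx.
  move=> xB; have := mcoboundaryB xB (GF n _ wx).
  rewrite !mulmxA opprB [X in mcoboundary _ X]addrC subrK.
  exact: (env_cocycle_free wB).
- apply: (free); apply: (eqvT _ _ _ (eqvS _ _ (Fw_i2 a))).
  apply: (eqvT) (Fw_i1 _); have := Fcob _ (tauE a).
  by rewrite mulmxBr !mulmxA.
Qed.
End Comparison.

(** * The homological integral and the fourth power of the antipode *)

Lemma AS_generator (k : fieldType) (A : algType k) (e : {rmorphism A -> k^o}) n :
  left_noetherian A -> (forall c, exists a, e a = c) -> left_AS_Gorenstein e n ->
  exists r (D : matcomplex A r) (z : 'cV[A]_(rk r n)),
    [/\ resolves D (fun a => e a = 0), generates_cohomology D z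
      & forall a b : A,
          (forall v : Ext_reg (trivmod e) n, (a : A^c) *: v = (b : A^c) *: v) ->
          mcoboundary D (z *m a%:M - z *m b%:M)].
Proof.
move=> An e_surj [_ _ [v v0 vspan]].
have [||r [D De]] := noetherian_resolution An (I := fun a => e a = 0).
- exact: rmorph0.
- by move=> a x y ex ey; rewrite rmorphD rmorphM ex ey mulr0 addr0.
have [z [Dz zB zv zspan]] := standard_generator e_surj De v0.
exists r, D, z; split=> //; last by move=> a b ab; apply: zv; exact: ab.
split=> // c Dc.
by have [t tB] := zspan k (fun t => t%:A) vspan c Dc; exists t.
Qed.

Theorem theorem3p1 (k : fieldType) (H : algType k) (hH : hopf_algebra H)
    (Hnoeth : noetherian H) (d : nat) (HAS : AS_Gorenstein hH d)
    (chi : {lrmorphism H -> k^o})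
    (chi_integral : forall (v : left_integral hH d) (a : H),
       (a : H^c) *: v = ((chi a : k)%:A : H^c) *: v) :
  exists xi_inv : H -> H,
    [/\ cancel (left_winding hH chi) xi_inv,
        cancel xi_inv (left_winding hH chi)
      & exists gamma : H -> H, inner_automorphism gamma /\
          forall a, iter 4 (antipode hH) a =
                    gamma (right_winding hH chi (xi_inv a))].
Proof.
pose S := antipode hH.
pose chiL : {linear H -> k^o} := chi.
pose chiS : {linear H -> k^o} := [the {linear H -> k^o} of chi \o S].
pose xi := left_winding hH chiL; pose xi' := left_winding hH chiS.
have xiK : cancel xi xi'.
  exact: (left_windingK (c := chiL) (d := chiS) (char_antipode_r hH chi)).
have xi'K : cancel xi' xi.
  exact: (left_windingK (c := chiS) (d := chiL) (char_antipode_l hH chi)).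
have phiK : cancel (right_winding hH chiL) (right_winding hH chiS).
  exact: (right_windingK (c := chiS) (d := chiL) (char_antipode_l hH chi)).
have eps_surj c : exists a, counit hH a = c.
  by exists (c%:A); rewrite linearZ rmorph1 [LHS]mulr1.
have [r [D [z [Deps zgen zchi]]]] :=
  AS_generator (e := counit hH) Hnoeth.1 eps_surj HAS.1.
have [s [E [w [Eeps wgen _]]]] :=
  AS_generator (e := conv_rmorph (counit hH)) Hnoeth.2 eps_surj HAS.2.
have {}zchi a : mcoboundary D (z *m a%:M - z *m ((chiL a : k)%:A : H)%:M).
  by apply: zchi => v; exact: chi_integral.
have [R [i1 [i2 env]]] := enveloping_exists H.
pose sigma a := S (S (xi a)).
have sigmaB x y : sigma (x - y) = sigma x - sigma y.
  by rewrite /sigma /xi !linearB.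
have unit_of u : (forall y, exists x, y = u * sigma x) ->
    exists v, u * v = 1 /\ v * u = 1.
  move=> /(_ 1)[x xE]; exists (sigma x).
  by split=> //; apply: (noetherian_dedekind_finite Hnoeth.1).
(* This [u] depends on an arbitrary right resolution and serves only for the bijectivity of [S]. *)
have [u [u_surj u_inj _]] := env_comparison env Deps zgen zchi Eeps wgen.
have [v [uv vu]] := unit_of u u_surj.
have S2_surj y : exists x, S (S x) = y.
  (* Cancelling the unit in [u * y = u * sigma x] exhibits [y] as [S (S (xi x))]. *)
  have [x xE] := u_surj (u * y); exists (xi x).
  by rewrite -[LHS]mul1r -vu -mulrA -[u * _]xE mulrA vu mul1r.
have S2_inj : injective (fun x => S (S x)).
  move=> x y /= xy; rewrite -(xi'K x) -(xi'K y); congr xi; apply/eqP.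
  rewrite -subr_eq0; apply/eqP; apply: u_inj.
  rewrite -[antipode hH _]/(sigma (xi' x - xi' y)) sigmaB /sigma !xi'K xy.
  by rewrite subrr mulr0.
have S_inj : injective S by move=> x y xy; apply: S2_inj; rewrite /= xy.
have /choice[T TK] : forall y, exists x, S x = y.
  by move=> y; have [x xE] := S2_surj y; exists (S x).
have KT : cancel S T by move=> x; apply: S_inj; rewrite TK.
pose Sc : H -> H^c := S.
have Sc_zmod : zmod_morphism Sc by move=> x y; exact: linearB.
have Sc_mon : monoid_morphism Sc.
  by split=> [|x y]; [exact: (antipode1 hH)|exact: (antipodeM hH)].
pose SR : {rmorphism H -> H^c} := HB.pack Sc
  (GRing.isZmodMorphism.Build H H^c Sc Sc_zmod)
  (GRing.isMonoidMorphism.Build H H^c Sc Sc_mon).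
pose E2 := map_complex SR D; pose w2 : 'cV[H^c]_(rk r d) := map_mx SR z.
have E2eps : resolves E2 (fun a => counit (hopf_opcop hH) a = 0).
  apply: eq_resolves (map_resolves (f := SR) (g := T) KT TK Deps) => a /=.
  by rewrite -[counit (hopf_opcop hH) a]/(counit hH a) -{2}[a]TK counit_antipode.
have cobS := map_coboundary (f := SR) (g := T) KT TK D.
have SRA t : SR (t%:A) = t%:A.
  by apply: etrans (linearZ_LR S _ _) _; rewrite [S 1]antipode1.
have [Dz zB zspan] := zgen.
have w2gen : @generates_cohomology k H^c r E2 d w2.
  split.
  - by rewrite /E2 /map_complex -map_mxM Dz map_mx0.
  - by move/cobS.
  move=> c Ec; pose c' : 'cV[H]_(rk r d) := map_mx T c.
  have cE : c = map_mx SR c'.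
    by apply/matrixP => i j; rewrite !mxE; exact: esym (TK _).
  have [|t tB] := zspan c'.
    apply/matrixP => i j; apply: S_inj.
    move: Ec; rewrite cE -map_mxM => /matrixP/(_ i j); rewrite !mxE => ->.
    exact: esym (linear0 S).
  exists t; move/cobS: tB; congr mcoboundary.
  rewrite map_mxB map_mxM map_scalar_mx -cE; congr (_ - _ *m _%:M); exact: SRA.
(* The transported generator carries [chi \o T]; by [charSS] this is [chi \o S], whose formula does
   not involve [T]. *)
pose chiK : {linear H^c -> k^o} := conv_linear_fun chiS.
have w2chi a : mcoboundary E2 (w2 *m a%:M - w2 *m ((chiK a : k)%:A : H^c)%:M).
  have /cobS := zchi (T a); congr mcoboundary.
  rewrite map_mxB !map_mxM !map_scalar_mx; congr (_ *m _%:M - _ *m _%:M).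
    exact: TK.
  apply: etrans (SRA _) _; congr (_ *: _).
  by rewrite -[RHS]/(chi (S a)) -{2}[a]TK charSS.
have [u2 [u2_surj _ u2_tau]] := env_comparison env Deps zgen zchi E2eps w2gen.
have [v2 [uv2 vu2]] := unit_of u2 u2_surj.
(* The twist lemma for [hopf_opcop] applies to [w2]; its left winding by [chiK] is the right winding
   by [chi \o S], that is [phi^-1]. *)
have u2E a : a * u2 = u2 * sigma (S (S (right_winding hH chiS a))).
  apply: (u2_tau (fun a => S (S (right_winding hH chiS a)))) => b.
  have := env_cocycle_i1 (hopf_opcop hH) (enveloping_opposite env) w2chi b.
  rewrite (left_winding_opcop hH chiS); exact.
exists xi'; split=> //; exists (fun a => v2 * a * u2); split.
  by exists v2, u2; split.
(* Applied to [phi (xi' a)], [u2E] cancels [phi]; moving [xi] inside past [S^2] then cancels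
   [xi']. *)
move=> a; rewrite -mulrA u2E phiK mulrA vu2 mul1r /sigma.
by rewrite /xi (left_winding_antipode2 hH chi) -/(xi (xi' a)) xi'K.
Qed.
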